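(* Let $H$ be a fixed graph with at least one edge and let $n \in \mathbb{N}$ be divisible by $|H|$. For every $\alpha > 0$ there is a constant $c = c(\alpha, H) > 0$ such that if $p = p(n) \geq c\, n^{-1/d^*(H)}$ and $G$ is an $n$-vertex graph with minimum degree $\delta(G) \geq \alpha n$, then asymptotically almost surely $G \cup G_{n,p}$ contains a perfect $H$-tiling.
   Context: All graphs are finite and simple. For a graph $H$, $|H|$ denotes its number of vertices and $e(H)$ its number of edges. For a graph $H$ on at least two vertices, $d(H) := \frac{e(H)}{|H|-1}$ and $d^*(H) := \max\{ d(H') : H' \subseteq H,\ |H'| \geq 2\}$, the maximum being over all subgraphs $H'$ of $H$ with at least two vertices. An $H$-tiling in a graph $G$ is a collection of vertex-disjoint copies of $H$ in $G$ (copies are not necessarily induced); it is perfect if it covers all vertices of $G$. An $n$-vertex graph is assumed to have vertex set $[n] = \{1,\dots,n\}$. $G_{n,p}$ is the Erdős–Rényi random graph on vertex set $[n]$ in which each edge is present with probability $p \in [0,1]$, independently of all other choices. If $G$ and $G'$ are $n$-vertex graphs, $G \cup G'$ is the (simple) graph on $[n]$ with edge set $E(G) \cup E(G')$. ''Asymptotically almost surely'' means with probability tending to $1$ as $n \to \infty$ (through multiples of $|H|$), for every choice of a sequence of graphs $G = G_n$ and of probabilities $p = p(n)$ satisfying the stated hypotheses; the constant $c$ depends only on $\alpha$ and $H$. *)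

(* Defs.v *)
From HB Require Import structures.
From mathcomp Require Import all_boot all_order all_algebra.
From mathcomp Require Import all_classical all_reals all_analysis.

Set Implicit Arguments.
Unset Strict Implicit.
Unset Printing Implicit Defensive.

Import Order.TTheory GRing.Theory Num.Theory.
Import numFieldNormedType.Exports.

Local Open Scope ring_scope.

Definition vpairs (V : finType) : {set {set V}} := [set e : {set V} | #|e| == 2%N].

(* A simple graph on the whole of V: its edges are two-element sets. *)
Record sgraph (V : finType) : Type := SGraph {
  edges :> {set {set V}};
  edges_sub : edges \subset vpairs V
}.

HB.instance Definition _ (V : finType) := [isSub for @edges V].
HB.instance Definition _ (V : finType) := [Finite of sgraph V by <:].

Lemma gunion_sub (V : finType) (G G' : sgraph V) :
  edges G :|: edges G' \subset vpairs V.
Proof. by rewrite finset.subUset !edges_sub. Qed.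

Definition gunion (V : finType) (G G' : sgraph V) : sgraph V :=
  SGraph (gunion_sub G G').

Definition degree (V : finType) (G : sgraph V) (v : V) : nat :=
  #|[set w : V | [set v; w] \in edges G]|.

(* Degrees are at most #|V|, so the default value of the minimum is only
   attained when V is empty, and it is then 0. *)
Definition min_degree (V : finType) (G : sgraph V) : nat :=
  \big[minn/#|V|]_(v : V) degree G v.

(* A pair S stands for the graph with vertex set S.1 and edge set S.2. *)
Definition is_subgraph (V : finType) (G : sgraph V)
    (S : {set V} * {set {set V}}) : bool :=
  (S.2 \subset edges G) && [forall e in S.2, e \subset S.1].

Definition density (R : realType) (V : finType)
    (S : {set V} * {set {set V}}) : R :=
  #|S.2|%:R / (#|S.1|.-1)%:R.

(* Densities are nonnegative, so the default value 0 does not affect the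
   maximum as soon as #|V| >= 2. *)
Definition dstar (R : realType) (V : finType) (H : sgraph V) : R :=
  \big[Num.max/0]_(S : {set V} * {set {set V}} |
      is_subgraph H S && (2 <= #|S.1|)%N) density R S.

(* S is a (not necessarily induced) subgraph of G isomorphic to H. *)
Definition is_copy (U V : finType) (H : sgraph U) (G : sgraph V)
    (S : {set V} * {set {set V}}) : bool :=
  is_subgraph G S &&
  [exists f : {ffun U -> V},
    [&& injectiveb f, S.1 == f @: [set: U]
      & S.2 == [set f @: (e : {set U}) | e in edges H]]].

Definition is_tiling (U V : finType) (H : sgraph U) (G : sgraph V)
    (T : {set {set V} * {set {set V}}}) : bool :=
  [forall S in T, is_copy H G S] &&
  [forall S in T, forall S' in T, (S != S') ==> [disjoint S.1 & S'.1]].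

Definition has_perfect_tiling (U V : finType) (H : sgraph U) (G : sgraph V) :
    bool :=
  [exists T : {set {set V} * {set {set V}}},
    is_tiling H G T && (\bigcup_(S in T) S.1 == [set: V])].

(* The probability of A for the random graph G_{n,p} on 'I_n, i.e. under the
   product of the Bernoulli(p) laws over all potential edges. *)
Definition gnp_prob (R : realType) (n : nat) (p : R)
    (A : pred (sgraph 'I_n)) : R :=
  \sum_(G : sgraph 'I_n | A G)
    \prod_(e in vpairs 'I_n) (if e \in edges G then p else 1 - p).

(* n tending to infinity through the multiples of k. *)
Definition multiples_oo (k : nat) : set_system nat :=
  within [set n : nat | (k %| n)%N]%classic (\oo)%classic.

(* Main.v *)
Require Import Defs.
From HB Require Import structures.
From mathcomp Require Import all_boot all_order all_algebra.
From mathcomp Require Import all_classical all_reals all_analysis.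
From mathcomp Require Import zify ring lra.

Set Implicit Arguments.
Unset Strict Implicit.
Unset Printing Implicit Defensive.

Import Order.TTheory GRing.Theory Num.Theory.
Import numFieldNormedType.Exports.

Local Open Scope ring_scope.

(* Let h = |H|, let u0 be a fixed vertex of H and let Gam be the random graph.
   Janson's inequality shows that, with probability 1 - exp(-Cn) for any
   prescribed C once c is large, Gam contains a copy of H from a given family of
   positive density of injections V(H) -> [n]; hence one may take a union bound
   over exp(O(n)) such families.

   Call a copy f of H in Gam swappable for a vertex w if f(u) is a G-neighbour of
   w for all u <> u0: then w can take over the place of f(u0).  Averaging over
   injections, for every D some copy is swappable for a positive proportion of
   the vertices of D, and one obtains disjoint copies, few in number, such that
   all but few vertices w have linearly many swappable copies among them.  The
   exceptional vertices are covered by copies placed in their G-neighbourhoods,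
   and the remaining vertices are tiled greedily inside Gam until at most eps n
   of them are left.  These are absorbed h at a time: the uncovered vertices w_u
   (u in V(H)) are swapped into distinct swappable copies, each in linearly many
   ways, and the released vertices are chosen to span a copy of H in Gam.  Each
   such step spoils only h of the copies, so linearly many stay available until
   the end. *)

Lemma card_bigcup_le (T I : finType) (P : pred I) (F : I -> {set T}) :
  (#|\bigcup_(i | P i) F i| <= \sum_(i | P i) #|F i|)%N.
Proof.
apply: (big_ind2 (fun (A : {set T}) k => #|A| <= k)%N) => //; first by rewrite cards0.
move=> A a B b Aa Bb; apply: leq_trans (leq_add Aa Bb).
by rewrite cardsU leq_subr.
Qed.

(** * Janson's inequality for random subsets *)

Section RandomSubset.
Variables (R : realType) (T : finType) (E : {set T}) (p : R).
Hypothesis p01 : 0 <= p <= 1.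

Definition weight (w : {set T}) : R :=
  \prod_(e in E) (if e \in w then p else 1 - p).

Definition mean (g : {set T} -> R) : R :=
  \sum_(w : {set T} | w \subset E) weight w * g w.

Lemma weight_ge0 w : 0 <= weight w.
Proof.
apply: prodr_ge0 => e _; case/andP: p01 => p0 p1.
by case: ifP => _ //; rewrite subr_ge0.
Qed.

Lemma le_mean (g1 g2 : {set T} -> R) :
  (forall w : {set T}, w \subset E -> g1 w <= g2 w) -> mean g1 <= mean g2.
Proof.
move=> le12; apply: ler_sum => w wE.
by rewrite ler_wpM2l ?weight_ge0 ?le12.
Qed.

Lemma eq_mean (g1 g2 : {set T} -> R) :
  (forall w : {set T}, w \subset E -> g1 w = g2 w) -> mean g1 = mean g2.
Proof. by move=> e12; apply: eq_bigr => w /e12->. Qed.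

Lemma mean_ge0 (g : {set T} -> R) : (forall w, 0 <= g w) -> 0 <= mean g.
Proof.
by move=> g0; apply: sumr_ge0 => w _; rewrite mulr_ge0 ?weight_ge0.
Qed.

Lemma meanD (g1 g2 : {set T} -> R) : mean (fun w => g1 w + g2 w) = mean g1 + mean g2.
Proof. by rewrite -big_split; apply: eq_bigr => w _; rewrite mulrDr. Qed.

Lemma meanZ (a : R) (g : {set T} -> R) : mean (fun w => a * g w) = a * mean g.
Proof. by rewrite /mean mulr_sumr; apply: eq_bigr => w _; rewrite mulrCA. Qed.

Lemma mean_sum (I : Type) (s : seq I) (g : I -> {set T} -> R) :
  mean (fun w => \sum_(i <- s) g i w) = \sum_(i <- s) mean (g i).
Proof. by rewrite /mean exchange_big; apply: eq_bigr => w _; rewrite mulr_sumr. Qed.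

Lemma mean_cond1 e (g : {set T} -> R) : e \in E ->
  mean (fun w => (e \in w)%:R * g w) = p * mean (fun w => g (e |: w)).
Proof.
move=> eE; rewrite /mean.
pose X := \sum_(w : {set T} | (w \subset E) && (e \in w)) weight w * g w.
have ->: \sum_(w : {set T} | w \subset E) weight w * ((e \in w)%:R * g w) = X.
  rewrite (bigID (fun w : {set T} => e \in w)) /= [X in _ + X]big1 ?addr0.
    by apply: eq_bigr => w /andP[_ ->]; rewrite mul1r.
  by move=> w /andP[_ /negPf->]; rewrite mul0r mulr0.
rewrite (bigID (fun w : {set T} => e \in w)) /= mulrDr.
have ->: \sum_(w : {set T} | (w \subset E) && (e \in w)) weight w * g (e |: w) = X.
  by apply: eq_bigr => w /andP[_ ew]; rewrite (finset.setUidPr _) ?finset.sub1set.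
(* Adding [e] to a set without it changes the weight by the factor [p / (1 - p)]; the identity is
   kept cross-multiplied so that [p = 1] is allowed. *)
suff ->: p * (\sum_(w : {set T} | (w \subset E) && (e \notin w)) weight w * g (e |: w))
       = (1 - p) * X by rewrite -mulrDl addrC subrK mul1r.
rewrite /X !mulr_sumr [RHS](reindex_onto (fun w : {set T} => e |: w) (fun w => w :\ e)) /=;
  last by move=> w /andP[_ ew]; rewrite finset.setD1K.
apply: eq_big => [w|w /andP[wE ew]].
  rewrite finset.subUset finset.sub1set eE /= finset.setU11 andbT; congr (_ && _).
  apply/idP/eqP => [ew|<-]; first by rewrite finset.setU1K.
  by rewrite !inE eqxx.
rewrite !mulrA; congr (_ * _).
rewrite /weight !(bigD1 e eE) /= finset.setU11 (negPf ew) !mulrA; congr (_ * _); first ring.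
by apply: eq_bigr => f /andP[_ fe]; rewrite !inE (negPf fe).
Qed.

(** Elements are kept independently, so conditioning on [A \subset w] costs [p ^+ #|A|] and amounts
    to forcing [A] into [w]. This replaces conditional expectations. *)
Lemma mean_cond (A : {set T}) (g : {set T} -> R) : A \subset E ->
  mean (fun w => (A \subset w)%:R * g w) = p ^+ #|A| * mean (fun w => g (A :|: w)).
Proof.
have [m] := ubnP #|A|; elim: m => // m IH in A g * => cardA AE.
have [->|[e eA]] := finset.set_0Vmem A.
  rewrite cards0 expr0 mul1r; apply: eq_mean => w _.
  by rewrite finset.sub0set finset.set0U mul1r.
move: cardA AE; rewrite -(finset.setD1K eA); set B := A :\ e => cardA.
have {}eA: e \notin B by rewrite !inE eqxx.
rewrite finset.subUset finset.sub1set => /andP[eE BE].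
rewrite cardsU1 eA in cardA *; rewrite exprS -mulrA.
transitivity (mean (fun w => (e \in w)%:R * ((B \subset w)%:R * g w))).
  apply: eq_mean => w _; rewrite finset.subUset finset.sub1set mulrA.
  by congr (_ * _); case: (e \in w); case: (B \subset w); rewrite ?mulr0 ?mulr1.
rewrite mean_cond1 //.
transitivity (p * mean (fun w => (B \subset w)%:R * g (e |: w))).
  congr (_ * _); apply: eq_mean => w _; congr (_%:R * _); congr nat_of_bool.
  apply/idP/idP => [/fintype.subsetP sA|sw]; last exact: fintype.subset_trans sw (finset.subsetUr _ _).
  by apply/fintype.subsetP => x xB; have := sA x xB; rewrite !inE; case: eqP xB eA => // -> ->.
rewrite IH //; congr (_ * (_ * _)); apply: eq_mean => w _.
by rewrite finset.setUA.
Qed.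

Lemma mean1 : mean (fun=> 1) = 1.
Proof.
(* Outside [E] presence has factor 0 and absence factor 1: expanding the product of the sums
   [F e + G e], all equal to 1, leaves only the subsets of [E]. *)
pose F e : R := if e \in E then p else 0.
pose G e : R := if e \in E then 1 - p else 1.
have := @bigA_distr R 0 1 *%R +%R T F G.
rewrite big1 => [dist1|e _]; last by rewrite /F /G; case: ifP => _ /=; rewrite ?add0r // addrC subrK.
rewrite [RHS]dist1 /mean.
rewrite [RHS](bigID (fun w : {set T} => w \subset E)) /= [X in _ + X]big1 ?addr0.
  apply: eq_bigr => w wE; rewrite mulr1 /weight big_mkcond; apply: eq_bigr => e _.
  rewrite /F /G; case: (boolP (e \in E)) => //; case: ifP => // ew.
  by rewrite (fintype.subsetP wE).
move=> w /subsetPn[e ew eE]; rewrite (bigD1 e) //= ew /F (negPf eE); exact: mul0r.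
Qed.

Lemma weierstrass_prod (I : Type) (s : seq I) (x : I -> R) :
  (forall i, 0 <= x i <= 1) -> 1 - \sum_(i <- s) x i <= \prod_(i <- s) (1 - x i).
Proof.
move=> x01; elim: s => [|i s IH]; first by rewrite !big_nil subr0.
rewrite !big_cons; have /andP[x0 x1] := x01 i.
have s0 : 0 <= \sum_(j <- s) x j by apply: sumr_ge0 => j _; case/andP: (x01 j).
have : (1 - x i) * (1 - \sum_(j <- s) x j) <= (1 - x i) * \prod_(j <- s) (1 - x j).
  by rewrite ler_wpM2l // subr_ge0.
by nra.
Qed.

Section Janson.
Variables (I : finType) (A : I -> {set T}) (q : R).
Hypothesis AE : forall i, A i \subset E.
Hypothesis q01 : 0 <= q <= 1.

Let term i (w : {set T}) : R := 1 - q * (A i \subset w)%:R.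
(* The product over [s] is at least the indicator that no [A i] lies in [w]; the
   parameter [q] thins the events, to be used when their correlations dominate. *)
Let surv s w : R := \prod_(i <- s) term i w.

Let term01 i w : 0 <= term i w <= 1.
Proof. by rewrite /term; case/andP: q01 => ? ?; case: (_ \subset _); rewrite ?mulr1 ?mulr0; lra. Qed.

Let surv01 s w : 0 <= surv s w <= 1.
Proof.
rewrite /surv; apply/andP; split; first by apply: prodr_ge0 => i _; case/andP: (term01 i w).
by apply: prodr_ile1 => i _.
Qed.

(** Summed over [J] this is mu - Delta for the events thinned by [q]. Delta runs over ordered pairs
    and contains the diagonal term [j = i] whenever [A i] is nonempty. *)
Definition janson_loss (J : {set I}) i : R :=
  q * (p ^+ #|A i| -
    q * \sum_(j in J | ~~ [disjoint A i & A j]) p ^+ #|A i :|: A j|).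

(** Factors are added one at a time. For a new index [i], the factors with [A j] disjoint from [A i]
    do not feel the conditioning on [A i]; the overlapping ones are handled by a union bound. The
    loss refers to a fixed [J] containing [s], so it does not depend on the order of [s]. *)
Lemma mean_surv (J : {set I}) s : uniq s -> {subset s <= J} ->
  mean (surv s) <= expR (- \sum_(i <- s) janson_loss J i).
Proof.
have [p0 p1] := andP p01; have [q0 q1] := andP q01.
elim: s => [_ _|i s IH /= /andP[si us] sJ].
  rewrite big_nil oppr0 expR0 -mean1; apply: le_mean => w _; by rewrite /surv big_nil.
have sJ' : {subset s <= J} by move=> j js; apply: sJ; rewrite inE js orbT.
rewrite big_cons opprD expRD mulrC; have {IH} := IH us sJ'.
set Phi := mean (surv s) => IH.
suff step: mean (surv (i :: s)) <= Phi * expR (- janson_loss J i).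
  by apply: le_trans step _; rewrite ler_wpM2r ?expR_ge0.
have Phi0 : 0 <= Phi by apply: mean_ge0 => w; case/andP: (surv01 s w).
pose far := [seq j <- s | [disjoint A i & A j]].
pose near := [seq j <- s | ~~ [disjoint A i & A j]].
pose Psi := mean (surv far).
have survE w : surv s w = surv near w * surv far w.
  by rewrite /surv !big_filter (bigID (fun j => [disjoint A i & A j])) /= mulrC.
have PhiPsi : Phi <= Psi.
  apply: le_mean => w _; rewrite survE ler_piMl //.
    by case/andP: (surv01 far w).
  by case/andP: (surv01 near w).
set B : R := p ^+ #|A i| - q * \sum_(j in J | ~~ [disjoint A i & A j]) p ^+ #|A i :|: A j|.
have Psi0 : 0 <= Psi by apply: le_trans PhiPsi.
have consE : mean (surv (i :: s)) =
    Phi - q * mean (fun w => (A i \subset w)%:R * surv s w).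
  rewrite -mulNr -meanZ -meanD; apply: eq_mean => w _.
  by rewrite /surv big_cons /term; ring.
have farE : mean (fun w => (A i \subset w)%:R * surv far w) = p ^+ #|A i| * Psi.
  rewrite mean_cond //; congr (_ * _); apply: eq_mean => w _.
  rewrite /surv !big_filter; apply: eq_bigr => j dij; congr (1 - q * _%:R).
  congr nat_of_bool; apply/idP/idP => [/fintype.subsetP Ajs|sw]; last exact: fintype.subset_trans sw (finset.subsetUr _ _).
    apply/fintype.subsetP => x xAj; have := Ajs x xAj; rewrite inE => /orP[] //.
    by move=> xAi; case/negP: (disjointFr dij xAi).
(* Forcing more elements into [w] only lowers the survival factors; this monotonicity does the work
   of a correlation inequality. *)
have nearE j : mean (fun w => (A i :|: A j \subset w)%:R * surv far w)
    <= p ^+ #|A i :|: A j| * Psi.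
  rewrite mean_cond ?finset.subUset ?AE // ler_wpM2l ?exprn_ge0 //.
  apply: le_mean => w _; apply: ler_prod => k _.
  have /andP[-> _] /= := term01 k (A i :|: A j :|: w).
  rewrite lerD2l lerN2 ler_wpM2l // ler_nat.
  case: (boolP (A k \subset w)) => //= Akw.
  by rewrite (fintype.subset_trans Akw) ?finset.subsetUr.
have low : B * Psi <= mean (fun w => (A i \subset w)%:R * surv s w).
  apply: (@le_trans _ _ (p ^+ #|A i| * Psi -
     q * \sum_(j <- near) mean (fun w => (A i :|: A j \subset w)%:R * surv far w))).
    rewrite mulrBl lerD2l lerN2 -mulrA ler_wpM2l // mulr_suml big_filter.
    apply: (@le_trans _ _ (\sum_(j <- s | ~~ [disjoint A i & A j]) p ^+ #|A i :|: A j| * Psi)).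
      by apply: ler_sum => j _.
    rewrite [leLHS]big_mkcond big_uniq //= [leLHS]big_mkcond [leRHS]big_mkcond /=.
    apply: ler_sum => j _; case: ifPn => [/sJ' ->//|_].
    by case: ifP => // _; rewrite mulr_ge0 ?exprn_ge0.
  rewrite -farE -mean_sum -mulNr -meanZ -meanD; apply: le_mean => w _.
  rewrite survE; have /andP[f0 f1] := surv01 far w.
  case: (boolP (A i \subset w)) => Aiw; last first.
    rewrite !mul0r add0r mulr_le0_ge0 ?oppr_le0 // sumr_ge0 // => j _.
    by rewrite mulr_ge0.
  rewrite !mul1r (eq_bigr (fun j => (A j \subset w)%:R * surv far w)); last first.
    by move=> j _; rewrite finset.subUset Aiw.
  rewrite -mulr_suml mulrA -{1}[surv far w]mul1r -mulrDl ler_wpM2r //.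
  rewrite mulNr mulr_sumr; apply: weierstrass_prod => j.
  by case: (_ \subset w); rewrite ?mulr1 ?mulr0 ?q0 ?q1 ?lexx ?ler01.
(* For [0 <= B], use [Phi <= Psi] and [1 - x <= expR (- x)]. For [B < 0] the exponential is at least
   1, while a further factor cannot increase the mean. *)
rewrite consE; have [B0|B0] := leP 0 B.
  apply: (@le_trans _ _ (Phi * (1 - q * B))).
    rewrite mulrBr mulr1 lerD2l lerN2 mulrCA ler_wpM2l // (le_trans _ low) //.
    by rewrite mulrC ler_wpM2l.
  rewrite ler_wpM2l //; have := expR_ge1Dx (- janson_loss J i).
  by rewrite /janson_loss.
apply: (@le_trans _ _ Phi).
  rewrite lerBlDr lerDl mulr_ge0 // mean_ge0 // => w.
  by rewrite mulr_ge0 //; case/andP: (surv01 s w).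
rewrite ler_peMr // -expR0 ler_expR oppr_ge0 /janson_loss mulr_ge0_le0 //.
exact: ltW.
Qed.

Lemma janson (J : {set I}) :
  mean (fun w => [forall i in J, ~~ (A i \subset w)]%:R) <=
    expR (- \sum_(i in J) janson_loss J i).
Proof.
apply: le_trans (le_trans (mean_surv (J := J) (enum_uniq J) _) _); last 2 first.
- by move=> i; rewrite mem_enum.
- by rewrite big_enum.
apply: le_mean => w _; case: forallP => [none|_]; last by case/andP: (surv01 (enum J) w).
rewrite /surv big1_seq // => i /=; rewrite mem_enum => iJ; rewrite /term.
by have := none i; rewrite iJ /= => /negPf->; rewrite mulr0 subr0.
Qed.
End Janson.
End RandomSubset.

(** * Copies of H in the random graph *)

Definition copy_edges (U V : finType) (H : sgraph U) (f : {ffun U -> V}) :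
    {set {set V}} := [set f @: (e : {set U}) | e in edges H].

Lemma card_copy_edges (U V : finType) (H : sgraph U) (f : {ffun U -> V}) :
  injective f -> #|copy_edges H f| = #|edges H|.
Proof. by move=> fI; rewrite card_imset //; apply: finset.imset_inj. Qed.

Lemma copy_edges_sub (U V : finType) (H : sgraph U) (f : {ffun U -> V}) :
  injective f -> copy_edges H f \subset vpairs V.
Proof.
move=> fI; apply/fintype.subsetP => _ /finset.imsetP[e eH ->].
have := fintype.subsetP (edges_sub H) e eH.
by rewrite !inE card_imset.
Qed.

Lemma edge_card (U : finType) (H : sgraph U) (e : {set U}) :
  e \in edges H -> #|e| = 2%N.
Proof. by move=> /(fintype.subsetP (edges_sub H)); rewrite inE => /eqP. Qed.

Lemma card_set_ffun (U V : finType) (F : U -> {set V}) :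
  #|[set f : {ffun U -> V} | [forall u, f u \in F u]]| = (\prod_u #|F u|)%N.
Proof.
rewrite -[RHS](_ : foldr muln 1%N [seq #|F x| | x : U] = _)%N.
  by rewrite -card_family -cardsE; apply: eq_card => f; rewrite !inE; apply/forallP/familyP.
by rewrite foldrE big_map big_enum.
Qed.

Section Spread.
Variables (R : realType) (U V : finType) (H : sgraph U) (c p : R).
Hypothesis hH : (0 < #|edges H|)%N.
Hypothesis c1 : 1 <= c.
Hypothesis V0 : (0 < #|V|)%N.
Hypothesis p01 : 0 < p <= 1.
Local Notation n := (#|V|%:R : R).
Local Notation h := #|U|.
Hypothesis spread : forall S, is_subgraph H S -> (2 <= #|S.1|)%N ->
  (c / n) ^+ #|S.1|.-1 <= p ^+ #|S.2|.

Let n0 : 0 < n. Proof. by rewrite ltr0n. Qed.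
Let c0 : 0 < c. Proof. exact: lt_le_trans c1. Qed.
Let p0 : 0 < p. Proof. by case/andP: p01. Qed.

(** The common edges, pulled back by [g], form a subgraph of [H] on [W]. If there are m of them, the
    union has 2e(H) - m edges, and by [spread] dividing by [p ^+ m] costs at most
    [(n / c) ^+ #|W|.-1], where one factor [1 / c] is kept. *)
Lemma overlap_term (f g : {ffun U -> V}) : injective f -> injective g ->
    ~~ [disjoint copy_edges H f & copy_edges H g] ->
    let W := [set u | g u \in f @: [set: U]] in
  (2 <= #|W|)%N /\
  p ^+ #|copy_edges H f :|: copy_edges H g| <=
    p ^+ (2 * #|edges H|) * (n ^+ #|W|.-1 / c).
Proof.
move=> fI gI ndis W.
pose F := [set e in edges H | g @: (e : {set U}) \in copy_edges H f].
have FW e : e \in F -> e \subset W.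
  rewrite inE => /andP[_ /finset.imsetP[e' _ ee']].
  apply/fintype.subsetP => u ue; rewrite inE.
  have: g u \in g @: (e : {set U}) by apply: imset_f.
  by rewrite ee' => /finset.imsetP[v _ ->]; apply: imset_f.
have cardF : #|F| = #|copy_edges H f :&: copy_edges H g|.
  rewrite -(card_imset F (finset.imset_inj gI)); apply: eq_card => e.
  rewrite inE andbC; apply/finset.imsetP/andP.
    by move=> [e']; rewrite inE => /andP[e'H e'f] ->; split=> //; apply: imset_f.
  by move=> [/finset.imsetP[e' e'H ->] ef]; exists e' => //; rewrite inE e'H.
have subF : is_subgraph H (W, F).
  apply/andP; split => /=; first by apply/fintype.subsetP => e; rewrite inE => /andP[].
  by apply/forallP => e; apply/implyP; apply: FW.
have W2 : (2 <= #|W|)%N.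
  move: ndis; rewrite -setI_eq0 -card_gt0 -cardF card_gt0 => /finset.set0Pn[e eF].
  rewrite -(@edge_card _ H e) ?subset_leq_card ?FW //.
  by move: eF; rewrite inE => /andP[].
split=> //; have := spread subF W2; rewrite /= cardF => sp.
set m := #|_ :&: _| in sp.
have cU : (#|copy_edges H f :|: copy_edges H g| + m = 2 * #|edges H|)%N.
  rewrite cardsU !card_copy_edges // /m subnK ?mul2n ?addnn //.
  rewrite (leq_trans (subset_leq_card (finset.subsetIl _ _))) // card_copy_edges //.
  by rewrite -addnn leq_addr.
rewrite -cU exprD -mulrA ler_peMr ?(exprn_ge0 _ (ltW p0)) //.
have kW : (0 < #|W|.-1)%N by rewrite -ltnS prednK // ltnW.
apply: (@le_trans _ _ ((c / n) ^+ #|W|.-1 * (n ^+ #|W|.-1 / c))); last first.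
  by rewrite ler_wpM2r // divr_ge0 ?exprn_ge0 ?ltW.
rewrite exprMn -mulrA [X in _ * X]mulrA -exprMn mulVf ?gt_eqF // expr1n mul1r.
by rewrite ler_pdivlMr // mul1r -{1}[c]expr1 ler_weXn2l.
Qed.

(** Group the maps [g] by [W]: at most [h ^ #|W| * #|V| ^ (h - #|W|)] of them share a given [W],
    which against [n ^+ #|W|.-1 / c] leaves the order [n ^+ h.-1 / c] for each of the [2 ^ h]
    sets. *)
Lemma overlap_sum (f : {ffun U -> V}) (J : {set {ffun U -> V}}) :
    injective f -> (forall g, g \in J -> injective g) ->
  \sum_(g in J | ~~ [disjoint copy_edges H f & copy_edges H g])
      p ^+ #|copy_edges H f :|: copy_edges H g|
    <= ((2 * h) ^ h)%:R * n ^+ h.-1 / c * p ^+ (2 * #|edges H|).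
Proof.
move=> fI JI; pose Wf (g : {ffun U -> V}) := [set u | g u \in f @: [set: U]].
set K := p ^+ (2 * _).
rewrite (partition_big Wf (fun W => 2 <= #|W|)%N) /=; last first.
  by move=> g /andP[/JI gI ndis]; have [] := overlap_term fI gI ndis.
have K0 : 0 <= K by rewrite exprn_ge0 ?ltW.
apply: (@le_trans _ _ (\sum_(W : {set U}) (h ^ h)%:R * n ^+ h.-1 / c * K)); last first.
  rewrite sumr_const.
  have -> : #|{: {set U}}| = (2 ^ h)%N by rewrite -[h]cardsT -card_powerset; apply: eq_card => W; rewrite !inE finset.subsetT.
  by rewrite -[leLHS]mulr_natl expnMn natrM !mulrA.
rewrite [leRHS](bigID (fun W : {set U} => 2 <= #|W|)%N) /= -[leLHS]addr0 lerD //; last first.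
  by apply: sumr_ge0 => W _; apply: mulr_ge0 => //; rewrite divr_ge0 ?mulr_ge0 ?exprn_ge0 ?(ltW c0).
apply: ler_sum => W W2.
apply: (@le_trans _ _ (\sum_(g : {ffun U -> V} | [forall u, g u \in if u \in W then f @: [set: U] else [set: V]])
                          K * (n ^+ #|W|.-1 / c))).
  rewrite [leLHS]big_mkcond [leRHS]big_mkcond /=; apply: ler_sum => g _.
  case: ifP => [/andP[/andP[gJ ndis] /eqP gW]|_]; last first.
    by case: ifP => // _; apply: mulr_ge0 => //; rewrite divr_ge0 ?exprn_ge0 ?(ltW c0).
  have [_] := overlap_term fI (JI g gJ) ndis.
  rewrite -/(Wf g) gW => le1; case: forallP => // -[] u.
  by case: ifP; rewrite ?inE // -gW inE.
have -> : \sum_(g : {ffun U -> V} | [forall u, g u \in if u \in W then f @: [set: U] else [set: V]])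
     K * (n ^+ #|W|.-1 / c) = (\prod_u #|if u \in W then f @: [set: U] else [set: V]|)%:R * (K * (n ^+ #|W|.-1 / c)).
  by rewrite -card_set_ffun [RHS]mulr_natl -[RHS]sumr_const; apply: eq_bigl => g; rewrite inE.
have cardW : (\prod_u #|if u \in W then f @: [set: U] else [set: V]| =
    h ^ #|W| * #|V| ^ (h - #|W|))%N.
  rewrite (bigID (mem W)) /=; congr (_ * _)%N.
    rewrite (eq_bigr (fun=> h)); first by rewrite prod_nat_const.
    by move=> u ->; rewrite card_imset // cardsT.
  rewrite (eq_bigr (fun=> #|V|)); last by move=> u /negPf->; rewrite cardsT.
  by rewrite prod_nat_const; congr (_ ^ _)%N; rewrite -(cardsC W) addKn; apply: eq_card => u; rewrite !inE.
rewrite cardW natrM !natrX.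
have -> : h.-1 = (h - #|W| + #|W|.-1)%N.
  have : (#|W| <= h)%N by apply: max_card.
  by move: W2; lia.
have hW : (h%:R : R) ^+ #|W| <= h%:R ^+ h.
  rewrite -!natrX ler_nat leq_pexp2l ?max_card //.
  by apply: leq_trans (max_card (mem W)); apply: leq_trans W2.
have Z0 : 0 <= n ^+ (h - #|W|) * n ^+ #|W|.-1 / c * K.
  by apply: mulr_ge0 => //; rewrite divr_ge0 ?mulr_ge0 ?exprn_ge0 ?(ltW c0).
have le1 := ler_wpM2r Z0 hW.
by rewrite exprD; apply: le_trans (le_trans _ le1) _; rewrite le_eqVlt; apply/orP; left; apply/eqP; ring.
Qed.
End Spread.

(** * Maximum density and the threshold for [p] *)

Lemma dstar_ge (R : realType) (U : finType) (H : sgraph U) S :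
  is_subgraph H S -> (2 <= #|S.1|)%N ->
  (#|S.2|%:R : R) <= dstar R H * (#|S.1|.-1)%:R.
Proof.
move=> sS S2; rewrite -ler_pdivrMr; last by rewrite ltr0n; lia.
by apply: (@le_bigmax_cond _ R _ _ S); rewrite sS.
Qed.

Lemma dstar_ge1 (R : realType) (U : finType) (H : sgraph U) :
  (0 < #|edges H|)%N -> 1 <= dstar R H.
Proof.
rewrite card_gt0 => /finset.set0Pn[e eH].
have e2 := edge_card eH.
have sS : is_subgraph H (e, [set e]).
  rewrite /is_subgraph /= finset.sub1set eH /=.
  by apply/forallP => e'; apply/implyP; rewrite inE => /eqP->.
have := @dstar_ge R _ _ _ sS; rewrite /= e2 cards1 mulr1; exact.
Qed.

(* [n `^ (- 1 / dstar)] is the density at which every subgraph [S] of [H] has at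
   least about [n] expected copies. *)
Lemma spread_of_threshold (R : realType) (U : finType) (H : sgraph U)
    (c p : R) (n : nat) : (0 < #|edges H|)%N ->
  1 <= c -> (0 < n)%N -> p <= 1 -> c * n%:R `^ (- (dstar R H)^-1) <= p ->
  forall S, is_subgraph H S -> (2 <= #|S.1|)%N ->
  (c / n%:R) ^+ #|S.1|.-1 <= p ^+ #|S.2|.
Proof.
move=> hH c1 n0 p1 lep S sS S2.
have d1 := dstar_ge1 R hH; set d := dstar R H in d1 lep *.
have d0 : 0 < d by apply: lt_le_trans d1.
have c0 : 0 < c by apply: lt_le_trans c1.
have nR : 0 < n%:R :> R by rewrite ltr0n.
set t := _ * _ in lep; have t0 : 0 < t by rewrite mulr_gt0 // powR_gt0.
apply: (@le_trans _ _ (t ^+ #|S.2|)); last by rewrite lerXn2r ?nnegrE ?(ltW t0) // (le_trans (ltW t0)).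
rewrite -[leRHS]powR_mulrn ?(ltW t0) //.
(* As [t <= 1], raising the exponent from [#|S.2|] to [d * #|S.1|.-1] lowers the power. The new
   exponent turns the root of [n] in [t] into an integral power, and [c <= c ^ d] because
   [1 <= d]. *)
apply: (@le_trans _ _ (t `^ (d * (#|S.1|.-1)%:R))); last first.
  by apply: ger_powR; [rewrite t0 (le_trans lep) | apply: dstar_ge].
rewrite powRrM powR_mulrn ?powR_ge0 // lerXn2r ?nnegrE ?powR_ge0 //.
  by rewrite divr_ge0 ?(ltW c0).
rewrite powRM ?powR_ge0 ?(ltW c0) // -powRrM mulNr mulVf ?gt_eqF // powR_inv1 //.
by rewrite ler_wpM2r ?invr_ge0 // le1r_powR.
Qed.

Section CopyBound.
Variables (R : realType) (U V : finType) (H : sgraph U) (c p gamma : R).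
Hypothesis hH : (0 < #|edges H|)%N.
Hypothesis c1 : 1 <= c.
Hypothesis V0 : (0 < #|V|)%N.
Hypothesis p01 : 0 < p <= 1.
Hypothesis gamma01 : 0 < gamma <= 1.
Local Notation n := (#|V|%:R : R).
Local Notation h := #|U|.
Hypothesis spread : forall S, is_subgraph H S -> (2 <= #|S.1|)%N ->
  (c / n) ^+ #|S.1|.-1 <= p ^+ #|S.2|.

Lemma card_graph_ge2 : (2 <= h)%N.
Proof.
move: hH; rewrite card_gt0 => /finset.set0Pn[e eH].
by rewrite -(edge_card eH) max_card.
Qed.

(** Linear in [n], with a slope that grows with [c]: this is what beats exp(O(n)) families. *)
Definition rate : R := gamma ^+ 2 * c * n / (4 * ((2 * h) ^ h)%:R).

(** Janson's inequality, thinned until the correlations cost at most half of the first moment;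
    without thinning Delta may far exceed mu. *)
Lemma no_copy_bound (J : {set {ffun U -> V}}) :
    (forall f, f \in J -> injective f) -> gamma * n ^+ h <= #|J|%:R ->
  mean (vpairs V) p (fun w => [forall f in J, ~~ (copy_edges H f \subset w)]%:R)
    <= expR (- rate).
Proof.
move=> JI JC; have h2 := card_graph_ge2.
have [p0 p1] := andP p01; have [g0 g1] := andP gamma01.
have n0 : 0 < n by rewrite ltr0n.
have c0 : 0 < c by exact: lt_le_trans c1.
(* Intersecting with [vpairs V] makes [A f] admissible for every [f], injective or not; on [J] it
   changes nothing. *)
pose A (f : {ffun U -> V}) := copy_edges H f :&: vpairs V.
have AE f : f \in J -> A f = copy_edges H f.
  by move=> /JI fI; apply/finset.setIidPl; apply: copy_edges_sub.
have C1 : 1 <= ((2 * h) ^ h)%:R :> R by rewrite ler1n expn_gt0 muln_gt0 (ltnW h2).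
rewrite /rate; move: (overlap_sum hH c1 V0 p01 spread) C1; move: (_%:R) => C over C1.
set e := #|edges H|; set X := n ^+ h * p ^+ e.
have X0 : 0 < X by rewrite mulr_gt0 ?exprn_gt0.
have Xc : c * n <= X.
  have := @spread ([set: U], edges H); rewrite /= cardsT => sp.
  have {}sp : (c / n) ^+ h.-1 <= p ^+ e.
    apply: sp => //; rewrite /is_subgraph /= fintype.subxx.
    by apply/forallP => e'; apply/implyP => _; apply: finset.subsetT.
  have le1 : n ^+ h * (c / n) ^+ h.-1 <= X by rewrite ler_wpM2l // exprn_ge0 ?ltW.
  apply: le_trans le1.
  have -> : n ^+ h * (c / n) ^+ h.-1 = n * c ^+ h.-1.
    rewrite -[in n ^+ _](prednK (ltnW h2)) exprS -mulrA -exprMn [n * (_ / _)]mulrC divfK ?gt_eqF //.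
  by rewrite mulrC ler_wpM2l ?(ltW n0) // ler_eXnr // -subn1 subn_gt0.
(* Solves [q * (C * n ^+ h.-1 / c * p ^+ (2 * e)) = gamma * p ^+ e / 2], so that the correlations
   take at most half of [p ^+ e]. That [q <= 1] comes from [Xc], the spread condition for [H]
   itself. *)
pose q := gamma * c * n / (2 * C * X).
have C0 : 0 < C by apply: lt_le_trans C1.
have D0 : 0 < 2 * C * X by rewrite mulr_gt0 // mulr_gt0.
have q0 : 0 < q by apply: divr_gt0 => //; apply: mulr_gt0 => //; apply: mulr_gt0.
have q1 : q <= 1.
  rewrite ler_pdivrMr // mul1r.
  apply: (@le_trans _ _ (1 * (c * n))).
    by rewrite -mulrA ler_wpM2r // mulr_ge0 // ltW.
  by apply: ler_pM => //; [rewrite mulr_ge0 // ltW|lra].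
have q01 : 0 <= q <= 1 by rewrite ltW.
have := @janson R _ (vpairs V) p _ _ A q _ q01 J.
have -> : 0 <= p <= 1 by rewrite ltW.
move=> /(_ isT (fun f => finset.subsetIr _ _)) jan.
apply: le_trans (le_trans _ jan) _.
  apply: le_mean => [|w _]; first by rewrite ltW.
  rewrite ler_nat; case: (boolP [forall f in J, _]) => // /forallP none.
  rewrite lt0b; apply/forallP => f; apply/implyP => fJ; rewrite AE //.
  by have := none f; rewrite fJ.
rewrite ler_expR lerN2.
pose L := q * (p ^+ e / 2).
apply: (@le_trans _ _ (\sum_(f in J) L)); last first.
  apply: ler_sum => f fJ; rewrite /janson_loss AE // card_copy_edges; last exact: JI.
  rewrite ler_wpM2l ?(ltW q0) // lerBrDr -lerBrDl.
  rewrite (_ : \sum_(j in J | _) _ = \sum_(g in J | ~~ [disjoint copy_edges H f & copy_edges H g])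
      p ^+ #|copy_edges H f :|: copy_edges H g|); last first.
    by apply: eq_big => [g|g /andP[gJ _]]; [case: (boolP (g \in J)) => // gJ|]; rewrite !AE.
  have := over f J (JI f fJ) JI.
  move=> /(ler_wpM2l (ltW q0)) /le_trans; apply.
  rewrite -/e /q /X (mulnC 2%N) exprM.
  rewrite -[in n ^+ h](prednK (ltnW h2)) [n ^+ _.+1]exprS.
  have : 0 < n ^+ h.-1 by rewrite exprn_gt0.
  have : 0 < p ^+ e by rewrite exprn_gt0.
  move: (p ^+ e) (n ^+ h.-1) => b a b0 a0.
  rewrite [leLHS](_ : _ = gamma * b / 2); last first.
    by field; rewrite ?gt_eqF.
  by have : gamma * b <= 1 * b by [rewrite ler_wpM2r // ltW]; lra.
rewrite sumr_const -[L *+ _]mulr_natl.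
have L0 : 0 <= L by rewrite mulr_ge0 ?(ltW q0) // divr_ge0 ?exprn_ge0 ?ltW.
apply: le_trans (ler_wpM2r L0 JC).
rewrite /L /q.
rewrite /X le_eqVlt; apply/orP; left; apply/eqP.
have : 0 < n ^+ h by rewrite exprn_gt0.
have : 0 < p ^+ e by rewrite exprn_gt0.
by move: (p ^+ e) (n ^+ h) => b a b0 a0; field; rewrite ?gt_eqF.
Qed.

End CopyBound.

(** * The union bound for the random graph *)

Lemma sum_sgraph (R : realType) (V : finType) (F : {set {set V}} -> R) :
  \sum_(G : sgraph V) F (edges G) = \sum_(w : {set {set V}} | w \subset vpairs V) F w.
Proof.
rewrite [RHS](reindex_omap (val : sgraph V -> {set {set V}}) insub) /=; last first.
  by move=> w wV; rewrite insubT.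
apply: eq_bigl => G; rewrite edges_sub /=; apply/esym/eqP.
by rewrite -[edges G]/(val G) valK.
Qed.

Lemma gnp_prob_ge (R : realType) (n : nat) (p : R) (A : pred (sgraph 'I_n))
   (I : finType) (B : I -> pred {set {set 'I_n}}) :
  0 <= p <= 1 -> (forall G, [forall i, ~~ B i (edges G)] -> A G) ->
  1 - \sum_i mean (vpairs 'I_n) p (fun w => (B i w)%:R) <= gnp_prob p A <= 1.
Proof.
move=> p01 BA.
have tot := mean1 (vpairs 'I_n) p.
have gE : gnp_prob p A = \sum_(G : sgraph 'I_n) weight (vpairs 'I_n) p (edges G) * (A G)%:R.
  rewrite /gnp_prob big_mkcond; apply: eq_bigr => G _; rewrite /weight.
  by case: (A G); rewrite ?mulr1 ?mulr0.
have oneE : 1 = \sum_(G : sgraph 'I_n) weight (vpairs 'I_n) p (edges G).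
  rewrite (sum_sgraph (weight (vpairs 'I_n) p)) -[LHS]tot /mean.
  by apply: eq_bigr => w _; rewrite mulr1.
apply/andP; split; last first.
  rewrite gE [leRHS]oneE; apply: ler_sum => G _.
  by rewrite ler_piMr ?weight_ge0 // lern1 leq_b1.
rewrite lerBlDr -mean_sum [leLHS]oneE gE.
rewrite /mean -(sum_sgraph (fun w => weight _ p w * \sum_i (B i w)%:R)) -big_split /=.
apply: ler_sum => G _; rewrite -mulrDr ler_peMr ?weight_ge0 //.
case: (boolP (A G)) => [_|/negP nA]; first by rewrite lerDl sumr_ge0.
rewrite add0r; have /forallPn[i] : ~~ [forall i, ~~ B i (edges G)] by apply/negP => /BA.
rewrite negbK => Bi; rewrite (bigD1 i) //= Bi lerDl sumr_ge0 //.
Qed.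

(** * Tilings *)

Local Notation im f := (f @: [set: _]).

Lemma disjointI (T : finType) (A B : {set T}) :
  (forall x, x \in A -> x \in B -> False) -> [disjoint A & B].
Proof.
move=> AB; rewrite -setI_eq0; apply/eqP/setP => x; rewrite !inE.
by apply/negP => /andP[xA /(AB x xA)].
Qed.

Lemma disjointE (T : finType) (A B : {set T}) x :
  [disjoint A & B] -> x \in A -> x \in B -> False.
Proof. by move=> dAB xA xB; have := disjointFr dAB xA; rewrite xB. Qed.


Section Tileable.
Variables (U V : finType) (H : sgraph U) (K : sgraph V).

Definition is_tile (f : {ffun U -> V}) : bool :=
  injectiveb f && (copy_edges H f \subset edges K).

Lemma tile_inj f : is_tile f -> injective f.
Proof. by case/andP => /injectiveP. Qed.

(** Only the covered vertex set is recorded, since the construction just asks which vertices are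
    still free; [tileable_perfect] recovers the tiling. *)
Inductive tileable : {set V} -> Prop :=
| Tileable0 : tileable finset.set0
| TileableU (f : {ffun U -> V}) (X : {set V}) : is_tile f -> [disjoint im f & X] ->
    tileable X -> tileable (im f :|: X).

Lemma tileable_card (X : {set V}) : tileable X -> exists k, #|X| = (k * #|U|)%N.
Proof.
elim=> [|f Y tf dfY _ [k kE]]; first by exists 0%N; rewrite cards0.
exists k.+1; rewrite cardsU (disjoint_setI0 dfY) cards0 subn0 kE card_imset ?cardsT //.
exact: tile_inj.
Qed.

Lemma tileable_family (I : finType) (g : I -> {ffun U -> V}) (A : {set I}) (X : {set V}) :
  tileable X -> (forall i, i \in A -> is_tile (g i)) ->
  (forall i, i \in A -> [disjoint im (g i) & X]) ->
  (forall i j, i \in A -> j \in A -> i != j -> [disjoint im (g i) & im (g j)]) ->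
  tileable (X :|: \bigcup_(i in A) im (g i)).
Proof.
have [m] := ubnP #|A|; elim: m => // m IH in A *; move=> cA tX tg gX gg.
have [->|[i iA]] := finset.set_0Vmem A; first by rewrite finset.big_set0 finset.setU0.
rewrite (big_setD1 i iA) /= finset.setUCA; apply: TileableU; first exact: tg.
  apply: disjointI => x xi; rewrite inE => /orP[xX|/finset.bigcupP[j]].
    exact: disjointE (gX i iA) xi xX.
  rewrite !inE => /andP[ji jA] xj; apply: disjointE (gg i j iA jA _) xi xj.
  by rewrite eq_sym.
have sA j : j \in A :\ i -> j \in A by rewrite inE => /andP[].
apply: IH => //; first by rewrite (cardsD1 i) iA in cA.
- by move=> j /sA; apply: tg.
- by move=> j /sA; apply: gX.
- by move=> j k /sA jA /sA kA; apply: gg.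
Qed.

Lemma tileable_perfect : tileable [set: V] -> has_perfect_tiling H K.
Proof.
move=> tT.
suff: forall X : {set V}, tileable X -> exists T : {set {set V} * {set {set V}}},
    is_tiling H K T && (\bigcup_(S in T) S.1 == X).
  by move=> /(_ _ tT)[T hT]; apply/existsP; exists T.
move=> X; elim=> [|f Y tf dfY _ [T /andP[/andP[/forallP cT /forallP dT] /eqP covT]]].
  exists finset.set0; rewrite finset.big_set0 eqxx andbT.
  by apply/andP; split; apply/forallP => S; rewrite inE.
pose S0 := (im f, copy_edges H f).
exists (S0 |: T); have {}tf' := tf; move/andP: tf => [fI fK].
have sub1 S : S \in T -> S.1 \subset Y.
  by move=> ST; rewrite -covT; apply: finset.bigcup_sup.
apply/andP; split; last by rewrite finset.bigcup_setU finset.big_set1 covT.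
apply/andP; split.
  apply/forallP => S; apply/implyP; rewrite !inE => /orP[/eqP->|ST]; last first.
    by have := cT S; rewrite ST.
  apply/andP; split; last by apply/existsP; exists f; rewrite fI !eqxx.
  rewrite /is_subgraph fK; apply/forallP => e; apply/implyP => /finset.imsetP[e' _ ->].
  by apply: imsetS; apply: finset.subsetT.
have dS0 S : S \in T -> [disjoint im f & S.1].
  by move=> /sub1 SY; apply: disjointWr dfY.
apply/forallP => S; apply/implyP => SS; apply/forallP => S'; apply/implyP => SS'.
apply/implyP => nSS'; move: SS SS'; rewrite !inE.
move=> /orP[/eqP SE|ST] /orP[/eqP SE'|ST'].
- by rewrite SE SE' eqxx in nSS'.
- by rewrite SE; apply: dS0.
- by rewrite SE' disjoint_sym; apply: dS0.
- by have := dT S; rewrite ST /= => /forallP/(_ S'); rewrite ST' nSS'.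
Qed.

End Tileable.

(** * Families of disjoint tiles *)

Section Packing.
Variables (U V : finType) (H : sgraph U) (K : sgraph V).

Definition packing (P : {set {ffun U -> V}}) : bool :=
  [forall f in P, is_tile H K f] &&
  [forall f in P, forall g in P, (f != g) ==> [disjoint im f & im g]].

Definition cov (P : {set {ffun U -> V}}) : {set V} := \bigcup_(f in P) im f.

Lemma packing_tile P f : packing P -> f \in P -> is_tile H K f.
Proof. by case/andP => /forallP/(_ f) /implyP. Qed.

Lemma packing_eq P f g a b : packing P -> f \in P -> g \in P -> f a = g b -> f = g.
Proof.
move=> /andP[_ /forallP dP] fP gP fg; apply/eqP/negPn/negP => nfg.
have := dP f; rewrite fP => /forallP/(_ g); rewrite gP nfg /= => dfg.
by apply: (disjointE (x := f a) dfg); [|rewrite fg]; apply: imset_f.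
Qed.

Lemma covP (P : {set {ffun U -> V}}) x : reflect (exists2 f, f \in P & exists a, x = f a) (x \in cov P).
Proof.
apply: (iffP (finset.bigcupP)) => [[f fP /finset.imsetP[a _ ->]]|[f fP [a ->]]].
  by exists f => //; exists a.
by exists f => //; apply: imset_f.
Qed.

Lemma packing0 : packing finset.set0.
Proof. by apply/andP; split; apply/forallP => f; rewrite inE. Qed.


Lemma card_cov P : (#|cov P| <= #|P| * #|U|)%N.
Proof.
rewrite -sum_nat_const; apply: leq_trans (card_bigcup_le _ _) _.
by apply: leq_sum => f _; rewrite -[#|U|]cardsT leq_imset_card.
Qed.

Lemma packingU1 P f : packing P -> is_tile H K f -> [disjoint im f & cov P] ->
  packing (f |: P).
Proof.
move=> pP tf dfP; apply/andP; split.
  apply/forallP => g; apply/implyP; rewrite !inE => /orP[/eqP->//|].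
  exact: packing_tile.
have dfg g : g \in P -> [disjoint im f & im g].
  by move=> gP; apply: disjointWr dfP; apply: finset.bigcup_sup.
apply/forallP => g; apply/implyP => gP; apply/forallP => g'; apply/implyP => gP'.
apply/implyP => nSS'; move: gP gP'; rewrite !inE.
move=> /orP[/eqP SE|ST] /orP[/eqP SE'|ST'].
- by rewrite SE SE' eqxx in nSS'.
- by rewrite SE; apply: dfg.
- by rewrite SE' disjoint_sym; apply: dfg.
- by case/andP: pP => _ /forallP/(_ g); rewrite ST /= => /forallP/(_ g'); rewrite ST' nSS'.
Qed.

End Packing.

(** * Absorption by swaps *)

Section Swap.
Variables (U V : finType) (H : sgraph U) (G Gam : sgraph V) (u0 : U).
Local Notation K := (gunion G Gam).

Definition nbr (w : V) : {set V} := [set v | [set w; v] \in edges G].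

Lemma nbr_irr w v : v \in nbr w -> v != w.
Proof.
rewrite inE => /edge_card; apply: contra_eqN => /eqP->.
by rewrite finset.setUid cards1.
Qed.

Definition swappable (w : V) (f : {ffun U -> V}) : bool :=
  [forall u, (u != u0) ==> (f u \in nbr w)].

Lemma swappableP w (f : {ffun U -> V}) u : swappable w f -> u != u0 -> f u \in nbr w.
Proof. by move=> /forallP/(_ u)/implyP. Qed.

Definition swap (w : V) (f : {ffun U -> V}) : {ffun U -> V} :=
  [ffun u => if u == u0 then w else f u].

Lemma im_swapP w (f : {ffun U -> V}) x : x \in im (swap w f) -> x = w \/ exists2 u, u != u0 & x = f u.
Proof.
case/finset.imsetP => u _ ->; rewrite ffunE; case: eqP => [|/eqP uu]; first by left.
by right; exists u.
Qed.

Lemma swap_u0 w f : w \in im (swap w f).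
Proof. by apply/finset.imsetP; exists u0; rewrite ?ffunE ?eqxx. Qed.

Lemma swap_other w (f : {ffun U -> V}) u : u != u0 -> f u \in im (swap w f).
Proof. by move=> uu; apply/finset.imsetP; exists u; rewrite ?ffunE ?(negPf uu). Qed.

Lemma tile_gunionr f : is_tile H Gam f -> is_tile H K f.
Proof.
move=> /andP[fI fG]; apply/andP; split=> //.
exact: fintype.subset_trans fG (finset.subsetUr _ _).
Qed.

(** The edge images at [u0] lie in [G] by swappability, all others stay in [Gam]. Injectivity
    survives because no vertex is its own neighbour. *)
Lemma swap_tile w f : is_tile H Gam f -> swappable w f -> is_tile H K (swap w f).
Proof.
move=> tf gf; have fI := tile_inj tf; case/andP: tf => _ /fintype.subsetP fG.
apply/andP; split.
  apply/injectiveP => u v; rewrite !ffunE.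
  case: eqP => [->|/eqP uu]; case: eqP => [->|/eqP vv] // e.
  - by have := nbr_irr (swappableP gf vv); rewrite -e eqxx.
  - by have := nbr_irr (swappableP gf uu); rewrite e eqxx.
  - exact: fI.
apply/fintype.subsetP => _ /finset.imsetP[e eH ->]; rewrite inE.
have [u0e|u0e] := boolP (u0 \in e).
  have /eqP : #|e :\ u0| = 1%N.
    by have := edge_card eH; rewrite (cardsD1 u0) u0e => -[].
  move=> /cards1P[v ve]; have {ve}eE : e = [set u0; v] by rewrite -ve finset.setD1K.
  have vu : v != u0.
    by apply: contra_eqN (edge_card eH) => /eqP vu; rewrite eE vu finset.setUid cards1.
  rewrite eE imsetU1 imset_set1 !ffunE eqxx (negPf vu).
  by have := swappableP gf vu; rewrite inE => ->.
apply/orP; right; rewrite (_ : _ @: e = f @: e); first by apply: fG; apply: imset_f.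
apply: eq_in_imset => u ue; rewrite ffunE.
by case: eqP ue u0e => // -> ->.
Qed.

End Swap.

(** * A perfect tiling from two ways of finding copies *)

Section Assembly.
Variables (R : realType) (U V : finType) (H : sgraph U) (G Gam : sgraph V) (u0 : U).
Local Notation K := (gunion G Gam).
Local Notation n := (#|V|%:R : R).
Local Notation h := #|U|.
Local Notation nbr := (nbr G).
Local Notation swappable := (swappable G u0).
Variables (alpha gamma eta eps : R) (M : nat).
Hypotheses (alpha0 : 0 < alpha) (gamma0 : 0 < gamma) (eta0 : 0 < eta).
Hypotheses (eps0 : 0 < eps) (V0 : (0 < #|V|)%N).
(** This and [find_in] are all that is asked of [Gam]: the first builds the absorbing packing, the
    second places copies in prescribed large sets. *)
Hypothesis find_swappable : forall (Z D : {set V}), (#|Z|)%:R <= alpha * n / 4 ->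
  (0 < #|D|)%N -> exists f, [/\ is_tile H Gam f, [disjoint im f & Z] &
    gamma * (#|D|)%:R <= #|[set w in D | swappable w f]|%:R].
Hypothesis find_in : forall Y : U -> {set V}, (forall u, eps * n <= #|Y u|%:R) ->
  exists f, is_tile H Gam f /\ forall u, f u \in Y u.
Hypothesis deg : forall w, alpha * n <= #|nbr w|%:R.
Hypothesis M_le : 8 * h%:R * M%:R <= alpha * gamma * eta * n.
Hypothesis M_ge : 2 * eps * n <= M%:R.
Hypothesis eps_le : 2 * eps <= alpha.
Hypothesis eta_le : 8 * h%:R * eta <= alpha.

Let n0 : 0 < n. Proof. by rewrite ltr0n. Qed.

Definition score (P : {set {ffun U -> V}}) (w : V) : nat := #|[set f in P | swappable w f]|.

Lemma scoreE P w : score P w = (\sum_(f in P) swappable w f)%N.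
Proof.
rewrite /score -sum1_card big_mkcond [RHS]big_mkcond /=.
by apply: eq_bigr => f _; rewrite inE; case: (f \in P); case: (swappable w f).
Qed.

(** [P] is a largest packing whose potential is at least [gamma * eta * n] per tile. Capping each
    score at [M] bounds the potential by [n * M], hence bounds [#|P|]. If [eta * n] vertices scored
    below [M], [find_swappable] would enlarge [P]. *)
Lemma exists_scoring_packing : exists P, [/\ packing H Gam P,
  8 * (h%:R * #|P|%:R) <= alpha * n &
  #|[set w | (score P w < M)%N]|%:R < eta * n].
Proof.
pose pot P := (\sum_w minn (score P w) M)%N.
pose inv P := packing H Gam P && (gamma * (eta * n) * #|P|%:R <= (pot P)%:R).
have inv0 : inv finset.set0 by rewrite /inv packing0 cards0 mulr0 ler0n.
have bnd P : inv P -> 8 * (h%:R * #|P|%:R) <= alpha * n.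
  move=> /andP[_ le1].
  have le2 : (pot P <= #|V| * M)%N.
    by rewrite -sum_nat_const; apply: leq_sum => w _; apply: geq_minr.
  have le3 : gamma * eta * #|P|%:R <= M%:R.
    rewrite -(ler_pM2l n0) -natrM; apply: le_trans (le_trans le1 _).
      by rewrite le_eqVlt; apply/orP; left; apply/eqP; ring.
    by rewrite ler_nat.
  have ge0 : 0 < gamma * eta by apply: mulr_gt0.
  rewrite -(ler_pM2l ge0).
  have h0 : 0 <= 8 * h%:R :> R by apply: mulr_ge0.
  have := ler_wpM2l h0 le3; move: M_le.
  move: (h%:R : R) (M%:R : R) (#|P|%:R : R) n => a b c d; lra.
case: (@arg_maxnP _ finset.set0 inv (fun P => #|P|) inv0) => P invP maxP.
exists P; have [pP potP] := andP invP; split=> //; first exact: bnd.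
rewrite ltNge; apply/negP; set D := [set w | _] => Dbig.
have ZP : (#|cov P|)%:R <= alpha * n / 4.
  have := bnd P invP; have : (#|cov P|%:R : R) <= #|P|%:R * h%:R.
    by rewrite -natrM ler_nat card_cov.
  have : 0 < alpha * n by apply: mulr_gt0.
  by move: (h%:R : R) (#|P|%:R : R) n (#|_|%:R : R) => a b c d; nra.
have D0 : (0 < #|D|)%N.
  by rewrite -(ltr0n R); apply: lt_le_trans Dbig; apply: mulr_gt0.
have [f [tf dfP fD]] := find_swappable ZP D0.
have fP : f \notin P.
  apply/negP => fP; apply: (disjointE (x := f u0) dfP); first exact: imset_f.
  by apply/covP; exists f => //; exists u0.
have scoreU w : score (f |: P) w = (swappable w f + score P w)%N.
  by rewrite !scoreE big_setU1.
suff /maxP : inv (f |: P) by rewrite cardsU1 fP /geq /= add1n ltnn.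
apply/andP; split; first exact: packingU1.
(* Vertices of [D] score below the cap, so every gain there counts in full. *)
have : (pot P + #|[set w in D | swappable w f]| <= pot (f |: P))%N.
  rewrite /pot -sum1_card [X in (_ + X)%N]big_mkcond -big_split /=.
  apply: leq_sum => w _; rewrite scoreU !inE.
  case: (swappable w f); last by rewrite andbF addn0 add0n.
  rewrite andbT add1n; case: ltnP => [ltM|leM].
    by rewrite (minn_idPl ltM) addn1.
  by rewrite addn0 (minn_idPr _) // ltnW.
rewrite -(ler_nat R) natrD cardsU1 fP add1n -natr1; apply: le_trans.
by have := ler_wpM2l (ltW gamma0) Dbig; move: potP fD; lra.
Qed.

(** A copy found in the free part of the [G]-neighbourhood of [w] is swappable for [w], so [w] can
    replace its vertex at [u0]. Vertices of [C] are skipped, as the packing will cover them. *)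
Lemma cover_vertices (C : {set V}) (s : seq V) :
  8 * #|C|%:R <= alpha * n -> (size s)%:R <= eta * n ->
  exists X : {set V}, [/\ tileable H K X, [disjoint X & C],
    {subset s <= X :|: C} & (#|X| <= size s * h)%N].
Proof.
move=> Cle; elim: s => [_|w s IH] /=.
  exists finset.set0; split; rewrite ?cards0 //; first exact: Tileable0.
  by apply: disjointI => x; rewrite inE.
rewrite -[X in X%:R]addn1 natrD => sle.
have [|X [tX dXC sX cX]] := IH; first by move: sle; lra.
have [wX|wX] := boolP (w \in X :|: C).
  exists X; split=> //; last by apply: leq_trans cX _; rewrite leq_mul2r leqnSn orbT.
  by move=> x; rewrite inE => /orP[/eqP->|/sX].
(* [C] and [X] take at most [alpha * n / 8] each from the neighbourhood, and [eps <= alpha / 2]. *)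
have Yle : eps * n <= #|nbr w :\: (X :|: C)|%:R.
  have le1 : (#|nbr w| <= #|nbr w :\: (X :|: C)| + (#|X| + #|C|))%N.
    rewrite -(cardsID (X :|: C) (nbr w)) addnC leq_add2l.
    apply: leq_trans (subset_leq_card (finset.subsetIr _ _)) _.
    by rewrite cardsU leq_subr.
  move: le1; rewrite -(ler_nat R) !natrD => le1.
  have le2 : (#|X|%:R : R) <= (size s)%:R * h%:R by rewrite -natrM ler_nat.
  have h0 : 0 <= h%:R :> R by [].
  have le3 : h%:R * (size s)%:R <= h%:R * (eta * n) by rewrite ler_wpM2l //; move: sle; lra.
  have le4 := ler_wpM2r (ltW n0) eta_le; have le5 := ler_wpM2r (ltW n0) eps_le.
  have := deg w; have := mulr_gt0 alpha0 n0.
  move: le1 le2 le3 le4 le5 Cle; rewrite [_ * eta * _]mulrAC.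
  move: (eta * n) => en; nra.
have [f [tf fY]] := find_in (Y := fun=> nbr w :\: (X :|: C)) (fun=> Yle).
have fN u : f u \in nbr w by have := fY u; rewrite inE => /andP[].
have fX u : f u \notin X :|: C by have := fY u; rewrite inE => /andP[].
have gf : swappable w f by apply/forallP => u; rewrite fN implybT.
have swX x : x \in im (swap u0 w f) -> x \notin X :|: C.
  by case/im_swapP => [->|[u _ ->]].
exists (im (swap u0 w f) :|: X); split.
- apply: TileableU => //; first exact: swap_tile.
  by apply: disjointI => x /swX; rewrite inE negb_or => /andP[/negP].
- apply: disjointI => x; rewrite inE => /orP[/swX|xX xC]; last exact: disjointE dXC xX xC.
  by rewrite inE negb_or => /andP[_ /negP].
- move=> x; rewrite inE => /orP[/eqP->|/sX]; first by rewrite !inE swap_u0.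
  by rewrite !inE -orbA => ->; rewrite orbT.
- rewrite mulSn cardsU; apply: leq_trans (leq_subr _ _) _; apply: leq_add => //.
  by rewrite -[h]cardsT leq_imset_card.
Qed.

Lemma tile_remainder (C X : {set V}) : tileable H K X -> [disjoint X & C] ->
  exists Y : {set V}, [/\ tileable H K Y, [disjoint Y & C], X \subset Y &
    #|~: (Y :|: C)|%:R <= eps * n].
Proof.
have [m] := ubnP #|~: (X :|: C)|; elim: m => // m IH in X *; move=> cX tX dXC.
have [small|big] := leP (#|~: (X :|: C)|%:R : R) (eps * n); first by exists X.
have [f [tf fY]] := find_in (Y := fun=> ~: (X :|: C)) (fun=> ltW big).
have fX x : x \in im f -> x \in ~: (X :|: C) by case/finset.imsetP => u _ ->.
have XfX : X \subset im f :|: X by apply: finset.subsetUr.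
have [|||Y [tY dY fY' cY]] := IH (im f :|: X).
- apply: (@leq_trans #|~: (X :|: C)|) => //; apply: proper_card; rewrite properE; apply/andP; split.
    by rewrite finset.setCS finset.setSU.
  apply/subsetPn; exists (f u0); first exact: fY.
  by rewrite !inE imset_f.
- apply: TileableU => //; first exact: tile_gunionr.
  by apply: disjointI => x /fX; rewrite !inE negb_or => /andP[/negP].
- apply: disjointI => x; rewrite inE => /orP[/fX|xX xC]; last exact: disjointE dXC xX xC.
  by rewrite !inE negb_or => /andP[_ /negP].
by exists Y; split=> //; apply: fintype.subset_trans fY'.
Qed.

Lemma injection_into (A : {set V}) : (h <= #|A|)%N ->
  exists w : U -> V, injective w /\ forall u, w u \in A.
Proof.
move=> hA; exists (fun u => enum_val (widen_ord hA (enum_rank u))); split.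
  by move=> u v /enum_val_inj /(congr1 val) /= /val_inj /enum_rank_inj.
by move=> u; apply: enum_valP.
Qed.

(* The [h] uncovered vertices [w u] take over the spare vertices of [h] tiles of
   [P]; the spare vertices released are chosen so that they span a copy of [H]. *)
Lemma augment (P0 P : {set {ffun U -> V}}) (X : {set V}) :
  packing H Gam P0 -> P \subset P0 -> tileable H K X -> [disjoint X & cov P] ->
  (h <= #|~: (X :|: cov P)|)%N ->
  (forall w, w \notin X :|: cov P -> (M <= score P0 w)%N) ->
  #|P0 :\: P|%:R <= eps * n ->
  exists (P' : {set {ffun U -> V}}) (X' : {set V}),
    [/\ P' \subset P, tileable H K X' & [disjoint X' & cov P']] /\
    [/\ X :|: cov P \subset X' :|: cov P',
        (#|~: (X' :|: cov P')| = #|~: (X :|: cov P)| - h)%N &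
        (#|P0 :\: P'| <= #|P0 :\: P| + h)%N].
Proof.
move=> pP0 PP0 tX dXP hR scoreR lost.
have inP0 f : f \in P -> f \in P0 by apply: (fintype.subsetP PP0).
have [w [wI wR]] := injection_into hR.
have wX u : w u \notin X by have := wR u; rewrite !inE negb_or => /andP[].
have wP u : w u \notin cov P by have := wR u; rewrite !inE negb_or => /andP[].
(* The vertices that can be released by swapping [w u] into a tile of [P]. Different tiles release
   different vertices, and at least [M - eps * n >= eps * n] tiles are available. *)
pose Y u := [set f u0 | f : {ffun U -> V} in [set f in P | swappable (w u) f]].
have Ybig u : eps * n <= #|Y u|%:R.
  have -> : #|Y u| = #|[set f in P | swappable (w u) f]|.
    rewrite card_in_imset // => f g; rewrite !inE => /andP[fP _] /andP[gP _] fg.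
    exact: packing_eq pP0 (inP0 _ fP) (inP0 _ gP) fg.
  have le1 : (M <= #|[set f in P | swappable (w u) f]| + #|P0 :\: P|)%N.
    apply: leq_trans (scoreR (w u) _) _; first by have := wR u; rewrite inE.
    apply: leq_trans (leq_card_setU _ _).
    apply: subset_leq_card; apply/fintype.subsetP => f; rewrite !inE.
    by case/andP => -> ->; case: (f \in P).
  by move: le1; rewrite -(ler_nat R) natrD; move: M_ge lost; lra.
have [c [tc cY]] := find_in Ybig.
have /fin_all_exists[F FP] u : exists f, [/\ f \in P, swappable (w u) f & c u = f u0].
  by case/finset.imsetP: (cY u) => f; rewrite inE => /andP[fP gf] cf; exists f.
have FinP u : F u \in P by case: (FP u).
have cF u : c u = F u u0 by case: (FP u).
have cI := tile_inj tc.
(* The chosen tiles are automatically distinct, since they release the distinct vertices [c u]. *)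
have FI : injective F by move=> u v uv; apply: cI; rewrite !cF uv.
have Feq u v a b : F u a = F v b -> u = v.
  by move=> e; apply: FI; apply: packing_eq pP0 (inP0 _ (FinP u)) (inP0 _ (FinP v)) e.
have FuI u : injective (F u) by apply: tile_inj (packing_tile pP0 (inP0 _ (FinP u))).
have Fcov u a : F u a \in cov P by apply/covP; exists (F u) => //; exists a.
have wF u v a : w u <> F v a by move=> e; move: (wP u); rewrite e Fcov.
pose g u := swap u0 (w u) (F u).
pose B := \bigcup_(u in [set: U]) im (g u).
pose P' := P :\: (F @: [set: U]); pose X' := im c :|: (X :|: B).
have gX u x : x \in im (g u) -> x \notin X.
  case/im_swapP => [->//|[a _ ->]]; apply/negP => xX.
  exact: disjointE dXP xX (Fcov _ _).
have BP x : x \in B -> exists u, x \in im (g u) by case/finset.bigcupP => u _; exists u.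
have cP x : x \in im c -> exists u, x = F u u0.
  by case/finset.imsetP => u _ ->; exists u.
have tB : tileable H K (X :|: B).
  apply: tileable_family => // [u _|u _|u v _ _ uv].
  - case: (FP u) => FuP gF _; apply: swap_tile => //.
    exact: packing_tile pP0 (inP0 _ FuP).
  - by apply: disjointI => x /gX/negP.
  apply: disjointI => x /im_swapP[->|[a _ ->]] /im_swapP[|[b _]].
  - by move/wI => e; rewrite e eqxx in uv.
  - exact: wF.
  - by move/esym; apply: wF.
  - by move/Feq => e; rewrite e eqxx in uv.
have tX' : tileable H K X'.
  apply: TileableU => //; first exact: tile_gunionr.
  apply: disjointI => x /cP[v ->]; rewrite inE => /orP[xX|/BP[u]].
    exact: disjointE dXP xX (Fcov _ _).
  case/im_swapP => [/esym|[a au0 e]]; first exact: wF.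
  have uv := Feq _ _ _ _ e; rewrite uv in e; move: au0.
  by rewrite -(FuI _ _ _ e) eqxx.
(* The released vertices are covered again by [c], so the net gain is exactly the set of the
   [w u]. *)
have X'P x : (x \in X' :|: cov P') = (x \in X :|: cov P) || (x \in w @: [set: U]).
  apply/idP/idP.
    rewrite inE => /orP[|/covP[f]]; last first.
      rewrite inE => /andP[_ fP] [a ->]; apply/orP; left; rewrite inE; apply/orP; right.
      by apply/covP; exists f => //; exists a.
    rewrite inE => /orP[/cP[u ->]|]; first by rewrite inE Fcov orbT.
    rewrite !inE => /orP[->//|/BP[u /im_swapP[->|[a _ ->]]]].
      by rewrite imset_f ?orbT.
    by rewrite Fcov orbT.
  move=> /orP[|/finset.imsetP[u _ ->]]; last first.
    rewrite 3!inE; apply/orP; left; apply/orP; right; apply/orP; right.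
    by apply/finset.bigcupP; exists u => //; apply: swap_u0.
  rewrite inE => /orP[xX|/covP[f fP [a ->]]]; first by rewrite !inE xX orbT.
  have [/finset.imsetP[u _ fE]|fF] := boolP (f \in F @: [set: U]); last first.
    rewrite inE; apply/orP; right; apply/covP; exists f; last by exists a.
    by rewrite inE fF.
  rewrite fE 3!inE; apply/orP; left; have [->|au0] := eqVneq a u0.
    by rewrite -cF imset_f.
  apply/orP; right; apply/orP; right.
  by apply/finset.bigcupP; exists u => //; apply: swap_other.
exists P', X'; split; split=> //; first exact: finset.subsetDl.
- apply: disjointI => x; rewrite !inE => xX' /covP[f]; rewrite inE => /andP[fF fP] [b xE].
  have nF u a : F u a <> x.
    rewrite xE => e; case/negP: fF; rewrite -(packing_eq pP0 (inP0 _ (FinP u)) (inP0 _ fP) e).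
    exact: imset_f.
  case/orP: xX' => [/cP[u e]|/orP[xX|/BP[u]]]; first exact: nF (esym e).
    by apply: disjointE dXP xX _; apply/covP; exists f => //; exists b.
  case/im_swapP => [e|[a _ e]]; last exact: nF (esym e).
  by move: (wP u); rewrite -e => /negP[]; apply/covP; exists f => //; exists b.
- by apply/fintype.subsetP => x xX; rewrite X'P xX.
- have -> : ~: (X' :|: cov P') = ~: (X :|: cov P) :\: (w @: [set: U]).
    by apply/setP => x; rewrite !(finset.in_setD, finset.in_setC) X'P negb_or andbC.
  rewrite cardsD (finset.setIidPr _); first by rewrite card_imset // cardsT.
  by apply/fintype.subsetP => _ /finset.imsetP[u _ ->].
- apply: leq_trans (_ : _ <= #|(P0 :\: P) :|: (F @: [set: U])|)%N _.
    apply: subset_leq_card; apply/fintype.subsetP => f; rewrite !inE negb_and negbK.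
    by case: (f \in P0); case: (f \in P); case: (f \in _).
  apply: leq_trans (leq_card_setU _ _) _; rewrite leq_add2l -[h]cardsT.
  exact: leq_imset_card.
Qed.

(** Each round covers [h] new vertices and loses at most [h] tiles of [P0], so [#|P0 :\: P| + k * h]
    never grows and the losses stay within what [augment] tolerates. At the end the tiles left in
    [P] join the tiling. *)
Lemma tile_everything (P0 : {set {ffun U -> V}}) k : forall (P : {set {ffun U -> V}}) (X : {set V}),
  packing H Gam P0 -> P \subset P0 -> tileable H K X -> [disjoint X & cov P] ->
  #|~: (X :|: cov P)| = (k * h)%N ->
  (forall w, w \notin X :|: cov P -> (M <= score P0 w)%N) ->
  (#|P0 :\: P| + k * h)%:R <= eps * n -> tileable H K [set: V].
Proof.
elim: k => [|k IH] P X pP0 PP0 tX dXP cR scoreR lost.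
  have /eqP : #|~: (X :|: cov P)| = 0%N by rewrite cR.
  rewrite cards_eq0 => /eqP /(congr1 (@finset.setC _)).
  rewrite finset.setCK finset.setC0 => <-.
  have inP0 f : f \in P -> f \in P0 by apply: (fintype.subsetP PP0).
  apply: tileable_family => // [f /inP0 fP|f fP|f f' fP fP' ff'].
  - exact: tile_gunionr (packing_tile pP0 fP).
  - apply: disjointI => x xf xX; apply: disjointE dXP xX _.
    by apply/finset.bigcupP; exists f.
  - apply: disjointI => x /finset.imsetP[a _ ->] /finset.imsetP[b _ e].
    by move: ff'; rewrite (packing_eq pP0 (inP0 _ fP) (inP0 _ fP') e) eqxx.
have [||P' [X' [[P'P tX' dX'] [sub cR' lost']]]] := augment pP0 PP0 tX dXP _ scoreR _.
- by rewrite cR mulSn leq_addr.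
- by apply: le_trans lost; rewrite ler_nat leq_addr.
apply: (IH P' X') => //; first exact: fintype.subset_trans PP0.
- by rewrite cR' cR mulSn addKn.
- move=> x xX'; apply: scoreR; apply: contra xX'; exact: (fintype.subsetP sub).
apply: le_trans lost; rewrite ler_nat mulSn addnA leq_add2r //.
Qed.

Lemma perfect_tiling_of_finders : (h %| #|V|)%N -> has_perfect_tiling H K.
Proof.
move=> hV; apply: tileable_perfect.
have [P [pP Ple Dlt]] := exists_scoring_packing; set D := [set w | _] in Dlt.
have Cle : 8 * #|cov P|%:R <= alpha * n.
  apply: le_trans Ple; rewrite ler_pM2l // -natrM ler_nat mulnC; exact: card_cov.
have [|X [tX dX sX cX]] := cover_vertices (s := enum D) Cle; first by rewrite -cardE ltW.
have [Y [tY dY XY cY]] := tile_remainder tX dX.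
have hP : (h %| #|cov P|)%N.
  have tP : tileable H Gam (finset.set0 :|: cov P).
    apply: tileable_family; first exact: Tileable0.
    - by move=> f; apply: packing_tile pP.
    - by move=> f _; apply: disjointI => x _; rewrite inE.
    - move=> f f' fP fP' ff'; apply: disjointI => x /finset.imsetP[a _ ->] /finset.imsetP[b _ e].
      by move: ff'; rewrite (packing_eq pP fP fP' e) eqxx.
  by have [k] := tileable_card tP; rewrite finset.set0U => ->; apply: dvdn_mull.
have hY : (h %| #|Y|)%N by have [k ->] := tileable_card tY; apply: dvdn_mull.
(* Tiles cover multiples of [h] and [h] divides [#|V|], so rounds of [h] vertices exhaust the
   remainder exactly. *)
have hR : (h %| #|~: (Y :|: cov P)|)%N.
  have <- : (#|V| - (#|Y| + #|cov P|) = #|~: (Y :|: cov P)|)%N.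
    by rewrite -(cardsC (Y :|: cov P)) cardsU (disjoint_setI0 dY) cards0 subn0 addKn.
  by rewrite dvdn_subr ?dvdn_add // -(cardsC (Y :|: cov P)) cardsU (disjoint_setI0 dY) cards0 subn0 leq_addr.
have [k kE] := dvdnP hR.
apply: (tile_everything (P0 := P) (P := P) (k := k)) (kE) _ _ => //.
  move=> w wY; rewrite leqNgt; apply/negP => wD.
  have : w \in X :|: cov P by apply: sX; rewrite mem_enum inE.
  move: wY; rewrite !inE negb_or => /andP[wY /negPf->]; rewrite orbF => wX.
  by case/negP: wY; apply: (fintype.subsetP XY).
by rewrite finset.setDv cards0 add0n -kE.
Qed.

End Assembly.

(** * Dense families and the union bound *)

(* Redirecting [f v] to a constant is injective on the maps with [f u = f v]. *)
Lemma card_collision (U V : finType) (Y : U -> {set V}) (u v : U) : u != v ->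
  (#|[set f : {ffun U -> V} | [forall x, f x \in Y x] && (f u == f v)]| * #|Y v|
     <= \prod_x #|Y x|)%N.
Proof.
move=> uv; set A := [set f : {ffun U -> V} | _].
have [->|[f0 _]] := finset.set_0Vmem A; first by rewrite cards0.
pose reset (f : {ffun U -> V}) : {ffun U -> V} := [ffun x => if x == v then f0 v else f x].
rewrite (bigD1 v) //= mulnC leq_mul2l; apply/orP; right.
have <- : (\prod_x #|if x == v then [set f0 v] else Y x| = \prod_(x | x != v) #|Y x|)%N.
  rewrite (bigD1 v) //= eqxx cards1 mul1n.
  by apply: eq_bigr => x /negPf->.
rewrite -card_set_ffun.
have resetI : {in A &, injective reset}.
  move=> f g; rewrite !inE => /andP[_ /eqP fuv] /andP[_ /eqP guv] /ffunP fg.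
  apply/ffunP => x; have := fg x; rewrite !ffunE; case: eqP => // -> _.
  by have := fg u; rewrite !ffunE (negPf uv) -fuv -guv.
rewrite -(card_in_imset resetI); apply: subset_leq_card.
apply/fintype.subsetP => _ /finset.imsetP[f fA ->]; rewrite inE; apply/forallP => x.
rewrite ffunE; case: eqP => _; first by rewrite inE.
by move: fA; rewrite inE => /andP[/forallP/(_ x)].
Qed.

(** By [card_collision] each of the at most [#|U| ^ 2] ordered pairs collides in at most a
    proportion [1 / x] of the maps; as [2 * #|U| ^ 2 <= x], at least half of the maps are
    injective. *)
Lemma injections_many (R : realType) (U V : finType) (Y : U -> {set V}) (x : R) :
  (0 < #|U|)%N -> 2 * (#|U|%:R * #|U|%:R) <= x -> (forall u, x <= #|Y u|%:R) ->
  x ^+ #|U| <= 2 * #|[set f : {ffun U -> V} | injectiveb f && [forall u, f u \in Y u]]|%:R.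
Proof.
move=> U0 x_ge Yx; set A := [set f : {ffun U -> V} | _].
pose T := [set f : {ffun U -> V} | [forall u, f u \in Y u]].
pose N u v := [set f : {ffun U -> V} | [forall x, f x \in Y x] && (f u == f v)].
have h1 : 1 <= #|U|%:R :> R by rewrite ler1n.
have x0 : 0 < x by apply: lt_le_trans x_ge; nra.
have cT : #|T| = (\prod_u #|Y u|)%N by apply: card_set_ffun.
have Nle u v : u != v -> (#|N u v|%:R : R) <= #|T|%:R / x.
  move=> uv; rewrite ler_pdivlMr //; apply: le_trans (_ : #|N u v|%:R * #|Y v|%:R <= _).
    by rewrite ler_wpM2l.
  by rewrite -natrM ler_nat cT; apply: card_collision.
have TA : (#|T| <= #|A| + \sum_(u : U) \sum_(v | u != v) #|N u v|)%N.
  apply: (@leq_trans #|A :|: \bigcup_(u : U) \bigcup_(v | u != v) N u v|).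
    apply: subset_leq_card; apply/fintype.subsetP => f; rewrite !inE => fY.
    rewrite fY andbT; have [//|/injectivePn[u [v uv fuv]]] := boolP (injectiveb f).
    apply/finset.bigcupP; exists u => //; apply/finset.bigcupP; exists v; first by [].
    by rewrite inE fY fuv eqxx.
  apply: leq_trans (leq_card_setU _ _) _; rewrite leq_add2l.
  apply: leq_trans (card_bigcup_le _ _) _; apply: leq_sum => u _.
  exact: card_bigcup_le.
have Tge : x ^+ #|U| <= #|T|%:R.
  rewrite cT natr_prod -prodr_const; apply: ler_prod => u _.
  by rewrite (ltW x0) Yx.
move: TA; rewrite -(ler_nat R) natrD natr_sum => TA.
have : \sum_(u : U) (\sum_(v | u != v) #|N u v|)%:R <= \sum_(u : U) (#|U|%:R * (#|T|%:R / x)).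
  apply: ler_sum => u _; rewrite natr_sum mulr_natl -sumr_const.
  rewrite big_mkcond; apply: ler_sum => v _; case: ifP => [/Nle//|_].
  by rewrite divr_ge0 // ltW.
rewrite sumr_const -[_ *+ #|U|]mulr_natl => Sle.
have : #|U|%:R * (#|U|%:R * (#|T|%:R / x)) <= #|T|%:R / 2.
  rewrite !mulrA ler_pdivrMr // mulrAC.
  have := ler_wpM2r (ler0n R #|T|) x_ge; lra.
by move: TA Sle Tge; lra.
Qed.

Section Finders.
Variables (R : realType) (U V : finType) (H : sgraph U) (G Gam : sgraph V) (u0 : U).
Local Notation n := (#|V|%:R : R).
Local Notation h := #|U|.
Variables (alpha gamma eta eps gamma' : R).

(** [i.1] holds the vertices to be swapped in, [i.2] the target set of each vertex of [H]. An empty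
    [i.1] voids the last condition, so one kind of family serves both finders. *)
Definition scoring_family (i : {set V} * {ffun U -> {set V}}) : {set {ffun U -> V}} :=
  [set f : {ffun U -> V} | [&& injectiveb f, [forall u, f u \in i.2 u] &
     gamma * #|i.1|%:R <= #|[set w in i.1 | swappable G u0 w f]|%:R]].

(** With the density clause sparse families are never missed, so the Janson bound holds for every
    index. *)
Definition missed (i : {set V} * {ffun U -> {set V}}) (w : {set {set V}}) : bool :=
  (gamma' * n ^+ h <= #|scoring_family i|%:R) &&
  [forall f in scoring_family i, ~~ (copy_edges H f \subset w)].

Hypothesis alpha01 : 0 < alpha <= 1.
(** [gamma] is half the proportion that averaging gives in [find_swappable]; [eta] limits the cover
    of the exceptional vertices to [alpha * n / 8]; [eps] makes
    [alpha * gamma * eta = 32 * h * eps], which leaves room for [M] near [2 * eps * n]. *)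
Hypothesis gammaE : gamma = (alpha / 2) ^+ h / 4.
Hypothesis etaE : eta = alpha / (8 * h%:R).
Hypothesis epsE : eps = alpha * gamma * eta / (32 * h%:R).
Hypothesis gamma'_le : gamma' <= gamma.
Hypothesis gamma'_le2 : gamma' <= eps ^+ h / 2.
Hypothesis n_big : 2 * (h%:R * h%:R) <= eps * n.
Hypothesis deg : forall w, alpha * n <= #|nbr G w|%:R.
Hypothesis hits : forall i, ~~ missed i (edges Gam).

Let h0 : (0 < h)%N. Proof. by apply/card_gt0P; exists u0. Qed.
Let h1 : 1 <= h%:R :> R. Proof. by rewrite ler1n. Qed.
Let alpha0 : 0 < alpha. Proof. by case/andP: alpha01. Qed.
Let gamma0 : 0 < gamma. Proof. by rewrite gammaE divr_gt0 // exprn_gt0 // divr_gt0. Qed.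
Let gamma1 : gamma <= 1.
Proof.
rewrite gammaE; have /andP[a0 a1] := alpha01.
have : (alpha / 2) ^+ h <= 1 by apply: exprn_ile1; lra.
by lra.
Qed.
Let eta0 : 0 < eta. Proof. by rewrite etaE divr_gt0 // mulr_gt0 // ltr0n. Qed.
Let eta1 : eta <= 1.
Proof.
have /andP[a0 a1] := alpha01.
by rewrite etaE ler_pdivrMr ?mulr_gt0 ?ltr0n //; move: h1; lra.
Qed.
Let eps0 : 0 < eps. Proof. by rewrite epsE divr_gt0 ?mulr_gt0 ?ltr0n. Qed.
Let eps_le : 2 * eps <= alpha.
Proof.
rewrite epsE mulrA ler_pdivrMr ?mulr_gt0 ?ltr0n //.
have ge1 : gamma * eta <= 1 by rewrite mulr_ile1 // ltW.
have le1 : alpha * (gamma * eta) <= alpha by rewrite ler_piMr // ltW.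
have le2 : alpha * 1 <= alpha * h%:R by rewrite ler_wpM2l // ltW.
by move: le1 le2 alpha0; lra.
Qed.

Lemma find_in_scoring_family i : gamma' * n ^+ h <= #|scoring_family i|%:R ->
  exists2 f, f \in scoring_family i & is_tile H Gam f.
Proof.
move=> big; have := hits i; rewrite /missed big /= => /forallPn[f].
rewrite negb_imply negbK => /andP[fi fG]; exists f => //.
by move: fi; rewrite inE => /andP[fI _]; rewrite /is_tile fI.
Qed.

Lemma find_in (Y : U -> {set V}) : (forall u, eps * n <= #|Y u|%:R) ->
  exists f, is_tile H Gam f /\ forall u, f u \in Y u.
Proof.
move=> Yb; have [|f] := @find_in_scoring_family (finset.set0, [ffun u => Y u]); last first.
  rewrite inE /= => /and3P[_ /forallP fY _] tf; exists f; split=> // u.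
  by have := fY u; rewrite ffunE.
have := injections_many h0 n_big Yb; rewrite exprMn.
rewrite (_ : [set f : {ffun U -> V} | _] = scoring_family (finset.set0, [ffun u => Y u])).
  have n0 : 0 <= n ^+ h by rewrite exprn_ge0.
  by have := ler_wpM2r n0 gamma'_le2; lra.
apply/setP => f; rewrite !inE /= cards0 mulr0 ler0n andbT; congr (_ && _).
by apply: eq_forallb => u; rewrite ffunE.
Qed.

(** Double counting: each [w] is swappable for at least [2 * gamma * n ^+ h] injections avoiding
    [Z]. Those outside the family serve fewer than [gamma * #|D|] vertices each, so the family has
    at least [gamma * n ^+ h] members. *)
Lemma find_swappable (Z D : {set V}) : #|Z|%:R <= alpha * n / 4 -> (0 < #|D|)%N ->
  exists f, [/\ is_tile H Gam f, [disjoint im f & Z] &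
    gamma * #|D|%:R <= #|[set w in D | swappable G u0 w f]|%:R].
Proof.
move=> Zle D0; have [|f] := @find_in_scoring_family (D, [ffun u => ~: Z]); last first.
  rewrite inE /= => /and3P[_ /forallP fY gD] tf; exists f; split=> //.
  apply: disjointI => x /finset.imsetP[u _ ->]; have := fY u.
  by rewrite ffunE inE => /negP.
set F := scoring_family _; have N0 : 0 <= n ^+ h by rewrite exprn_ge0.
apply: le_trans (ler_wpM2r N0 gamma'_le) _.
pose A := [set f : {ffun U -> V} | injectiveb f && [forall u, f u \in ~: Z]].
have ge1 w : 4 * gamma * n ^+ h <= 2 * (\sum_(f in A) (swappable G u0 w f : nat))%:R.
  pose Y (u : U) := nbr G w :\: Z.
  have Yb u : alpha / 2 * n <= #|Y u|%:R.
    have := deg w; rewrite -(cardsID Z (nbr G w)) natrD.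
    have : (#|nbr G w :&: Z|%:R : R) <= #|Z|%:R.
      by rewrite ler_nat subset_leq_card // finset.subsetIr.
    have an0 : 0 <= alpha * n by rewrite mulr_ge0 // ltW.
    by move: Zle; rewrite /Y; lra.
  have nb : 2 * (h%:R * h%:R) <= alpha / 2 * n.
    by apply: le_trans n_big _; rewrite ler_wpM2r //; move: eps_le; lra.
  have := injections_many h0 nb Yb; rewrite exprMn => le1.
  rewrite gammaE [4 * _]mulrC divfK //; apply: le_trans le1 _.
  rewrite ler_pM2l // ler_nat -sum1_card [leqLHS]big_mkcond [leqRHS]big_mkcond /=.
  apply: leq_sum => f _; rewrite !inE; case: (injectiveb f) => //=.
  case: ifP => // /forallP fY.
  have -> : [forall u, f u \in ~: Z].
    by apply/forallP => u; have := fY u; rewrite !inE => /andP[].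
  rewrite (_ : swappable G u0 w f) //; apply/forallP => u; apply/implyP => _.
  by have := fY u; rewrite inE => /andP[].
have ge2 : #|D|%:R * (2 * gamma * n ^+ h) <=
    \sum_(f in A) (#|[set w in D | swappable G u0 w f]|%:R : R).
  have -> : \sum_(f in A) (#|[set w in D | swappable G u0 w f]|%:R : R) =
      \sum_(w in D) (\sum_(f in A) (swappable G u0 w f : nat))%:R.
    rewrite -natr_sum -[RHS]natr_sum exchange_big /=; congr _%:R.
    apply: eq_bigr => f _; rewrite -sum1_card big_mkcond [RHS]big_mkcond /=.
    by apply: eq_bigr => w _; rewrite inE; case: (w \in D); case: (swappable _ _ _ _).
  rewrite mulr_natl -sumr_const; apply: ler_sum => w _.
  by have := ge1 w; lra.
have le3 : \sum_(f in A) (#|[set w in D | swappable G u0 w f]|%:R : R) <=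
    #|F|%:R * #|D|%:R + n ^+ h * (gamma * #|D|%:R).
  apply: (@le_trans _ _ (\sum_(f : {ffun U -> V})
      ((if f \in F then #|D|%:R else 0) + gamma * #|D|%:R))); last first.
    rewrite big_split /= -big_mkcond /= sumr_const -[X in X + _]mulr_natl.
    by rewrite sumr_const -[X in _ + X]mulr_natl card_ffun natrX.
  rewrite big_mkcond; apply: ler_sum => f _; rewrite !inE /=.
  have -> : [forall u, f u \in [ffun=> ~: Z] u] = [forall u, f u \in ~: Z].
    by apply: eq_forallb => u; rewrite ffunE.
  have gD0 : 0 <= gamma * #|D|%:R by rewrite mulr_ge0 // ltW.
  case: (injectiveb f) => /=; last by rewrite add0r.
  case: ifP => _ /=; last by rewrite add0r.
  case: (leP (gamma * _)) => [_|/ltW le_g]; last by rewrite add0r.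
  apply: ler_wpDr => //; rewrite ler_nat subset_leq_card //.
  by apply/fintype.subsetP => w; rewrite inE => /andP[].
have D0' : 0 < #|D|%:R :> R by rewrite ltr0n.
rewrite -(ler_pM2l D0'); move: (le_trans ge2 le3); lra.
Qed.

Lemma perfect_tiling_of_hits : (h %| #|V|)%N -> has_perfect_tiling H (gunion G Gam).
Proof.
have n0 : 0 < n.
  rewrite -(pmulr_rgt0 _ eps0); apply: lt_le_trans n_big; move: h1; nra.
(* Scores are integers; [n_big] absorbs the rounding. *)
pose M := `|Num.ceil (2 * eps * n)|%N.
have ME : (M%:R : R) = (Num.ceil (2 * eps * n))%:~R.
  rewrite /M natr_absz ger0_norm // -(ler_int R).
  apply: le_trans (ceil_ge _); by rewrite !mulr_ge0 // ltW.
have M_ge : 2 * eps * n <= M%:R by rewrite ME ceil_ge.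
have M_le : M%:R <= 2 * eps * n + 1.
  by rewrite ME; have := ceilB1_lt (2 * eps * n); rewrite intrB; lra.
apply: (@perfect_tiling_of_finders R U V H G Gam u0 alpha gamma eta eps M) => //.
- by rewrite -(ltr0n R).
- exact: find_swappable.
- exact: find_in.
- have hp : 0 < h%:R :> R by rewrite ltr0n.
  have e1 : alpha * gamma * eta = 32 * h%:R * eps by rewrite epsE; field; rewrite gt_eqF.
  rewrite e1; have := ler_wpM2l (ltW hp) M_le.
  have := ler_wpM2l (ltW hp) n_big.
  have : 1 <= h%:R * h%:R :> R by move: h1; nra.
  move: h1; move: (M%:R : R) (h%:R : R) n => a b c; nra.
- by rewrite etaE mulrC divfK // gt_eqF // mulr_gt0 // ltr0n.
Qed.

End Finders.

(** * The probability estimate and the limit *)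

Lemma min_degree_le (V : finType) (G : sgraph V) w :
  (min_degree G <= #|nbr G w|)%N.
Proof.
rewrite /min_degree; have : w \in index_enum V by rewrite mem_index_enum.
elim: (index_enum V) => // v s IH; rewrite inE big_cons => /orP[/eqP->|/IH].
  exact: geq_minl.
by apply: leq_trans; apply: geq_minr.
Qed.

(** There are [2 ^ (h.+1 * n)] families, each missed with probability at most exp(-(h + 2)n). The
    union bound leaves exp(-n), which is at most 1/(n + 1). *)
Lemma probability_bound (R : realType) (U : finType) (H : sgraph U) (u0 : U)
    (alpha gamma eta eps gamma' c p : R) (n : nat) (G : sgraph 'I_n) :
  (0 < #|edges H|)%N -> 0 < alpha <= 1 ->
  gamma = (alpha / 2) ^+ #|U| / 4 -> eta = alpha / (8 * #|U|%:R) ->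
  eps = alpha * gamma * eta / (32 * #|U|%:R) ->
  0 < gamma' <= 1 -> gamma' <= gamma -> gamma' <= eps ^+ #|U| / 2 ->
  1 <= c -> (#|U| + 2)%:R <= gamma' ^+ 2 * c / (4 * ((2 * #|U|) ^ #|U|)%:R) ->
  p <= 1 -> c * n%:R `^ (- (dstar R H)^-1) <= p ->
  alpha * n%:R <= (min_degree G)%:R ->
  (0 < n)%N -> (#|U| %| n)%N -> 2 * (#|U|%:R * #|U|%:R) <= eps * n%:R ->
  1 - n.+1%:R^-1 <=
    gnp_prob p (fun Gnp : sgraph 'I_n => has_perfect_tiling H (gunion G Gnp)) <= 1.
Proof.
move=> hH alpha01 gammaE etaE epsE gam01 gam_le gam_le2 c1 c_big p1 lep deg n0 hn n_big.
set h := #|U| in c_big gammaE gam_le2 n_big hn *.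
have p0 : 0 < p.
  apply: lt_le_trans lep; rewrite mulr_gt0 ?powR_gt0 ?ltr0n //.
  exact: lt_le_trans c1.
have nE : #|'I_n| = n := card_ord n.
have spread : forall S, is_subgraph H S -> (2 <= #|S.1|)%N ->
    (c / #|'I_n|%:R) ^+ #|S.1|.-1 <= p ^+ #|S.2|.
  by rewrite nE; apply: spread_of_threshold.
pose B := missed (V := 'I_n) H G u0 gamma gamma'.
have p01 : 0 <= p <= 1 by rewrite ltW.
have [|lo hi] := andP (@gnp_prob_ge R n p
    (fun Gnp : sgraph 'I_n => has_perfect_tiling H (gunion G Gnp)) _ B p01 _).
  move=> Gam /forallP hits.
  apply: (@perfect_tiling_of_hits R U _ H G Gam u0 alpha gamma eta eps gamma') => //;
    rewrite ?nE //.
  move=> w; apply: le_trans deg _; rewrite ler_nat; exact: min_degree_le.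
rewrite hi andbT; apply: le_trans lo; rewrite lerD2l lerN2.
set r := rate U 'I_n c gamma'.
have Ble i : mean (vpairs 'I_n) p (fun w => (B i w)%:R) <= expR (- r).
  have [big|small] := boolP (gamma' * #|'I_n|%:R ^+ h <= #|scoring_family G u0 gamma i|%:R); last first.
    apply: le_trans (expR_ge0 _); rewrite /mean big1 // => w _.
    by rewrite /B /missed (negPf small) mulr0.
  apply: le_trans (@no_copy_bound R U _ H c p gamma' hH c1 _ _ gam01 spread
      (scoring_family G u0 gamma i) _ big).
  - by apply: le_mean => // w _; rewrite /B /missed big.
  - by rewrite nE.
  - by rewrite p0.
  - by move=> f; rewrite inE => /and3P[/injectiveP].
apply: (@le_trans _ _ (\sum_(i : {set 'I_n} * {ffun U -> {set 'I_n}}) expR (- r))).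
  by apply: ler_sum => i _.
rewrite sumr_const.
have -> : #|{: {set 'I_n} * {ffun U -> {set 'I_n}}}| = (2 ^ (h.+1 * n))%N.
  have c2 : #|{: {set 'I_n}}| = (2 ^ n)%N.
    by rewrite -[in RHS]nE -[in RHS]cardsT -card_powerset; apply: eq_card => W; rewrite !inE finset.subsetT.
  by rewrite card_prod card_ffun c2 -expnM -expnD mulSn mulnC.
rewrite -[leLHS]mulr_natl natrX.
have two : 2 <= expR 1 :> R by have := @expR_ge1Dx R 1; lra.
have e1 : (2 : R) ^+ (h.+1 * n) <= expR (h.+1 * n)%:R.
  by rewrite -[(h.+1 * n)%:R]mulr1 mulrC expRM_natr lerXn2r ?nnegrE ?expR_ge0.
apply: (@le_trans _ _ (expR (h.+1 * n)%:R * expR (- r))).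
  by rewrite ler_wpM2r ?expR_ge0.
rewrite -expRD.
have r_ge : (h + 2)%:R * n%:R <= r.
  rewrite /r /rate nE; have := ler_wpM2r (ler0n R n) c_big.
  by move/le_trans; apply; rewrite le_eqVlt; apply/orP; left; apply/eqP; rewrite mulrAC.
apply: (@le_trans _ _ (expR (- n%:R))).
  rewrite ler_expR; move: r_ge; rewrite natrM natrD -natr1; lra.
rewrite expRN lef_pV2 ?posrE ?expR_gt0 ?ltr0n //.
by rewrite -natr1 addrC expR_ge1Dx.
Qed.

Local Open Scope classical_set_scope.

Theorem theorem1p3 (R : realType) (U : finType) (H : sgraph U)
    (hH : (0 < #|edges H|)%N) (alpha : R) (halpha : 0 < alpha) :
  exists c : R, 0 < c /\
    forall (p : nat -> R) (G : forall n : nat, sgraph 'I_n),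
      (forall n : nat, 0 <= p n <= 1) ->
      (\forall n \near multiples_oo #|U|,
         c * n%:R `^ (- (dstar R H)^-1) <= p n) ->
      (\forall n \near multiples_oo #|U|,
         alpha * n%:R <= (min_degree (G n))%:R) ->
      gnp_prob (p n) (fun Gnp : sgraph 'I_n =>
                        has_perfect_tiling H (gunion (G n) Gnp))
        @[n --> multiples_oo #|U|] --> (1 : R).
Proof.
have h2 := card_graph_ge2 hH.
have [u0 _] : exists u0 : U, u0 \in U by apply/card_gt0P; exact: ltnW.
have hp : 0 < #|U|%:R :> R by rewrite ltr0n ltnW.
(* The finders want a degree constant at most 1; lowering it only weakens the degree condition. *)
pose a := Num.min alpha 1.
have a01 : 0 < a <= 1 by rewrite lt_min halpha ltr01 ge_min lexx orbT.
have [a0 a1] := andP a01.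
pose gamma := (a / 2) ^+ #|U| / 4; pose eta := a / (8 * #|U|%:R).
pose eps := a * gamma * eta / (32 * #|U|%:R).
have gamma0 : 0 < gamma by rewrite divr_gt0 // exprn_gt0 // divr_gt0.
have eta0 : 0 < eta by rewrite divr_gt0 // mulr_gt0.
have eps0 : 0 < eps by apply: divr_gt0; apply: mulr_gt0 => //; apply: mulr_gt0.
(* A density that the families of both finders reach, capped at 1 for [no_copy_bound]. *)
pose gamma' := Num.min (Num.min gamma (eps ^+ #|U| / 2)) 1.
have gamma'01 : 0 < gamma' <= 1.
  by rewrite !lt_min gamma0 divr_gt0 ?exprn_gt0 // ltr01 ge_min lexx orbT.
have [g0 _] := andP gamma'01.
have gam_le : gamma' <= gamma by rewrite !ge_min lexx.
have gam_le2 : gamma' <= eps ^+ #|U| / 2 by rewrite !ge_min lexx orbT.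
pose D : R := ((2 * #|U|) ^ #|U|)%:R.
have D0 : 0 < D by rewrite ltr0n expn_gt0 muln_gt0 (ltnW h2).
(* The second entry makes [rate] at least [(#|U| + 2) * n]. *)
pose c := Num.max 1 ((#|U| + 2)%:R * (4 * D) / gamma' ^+ 2).
have c1 : 1 <= c by rewrite le_max lexx.
have c_big : (#|U| + 2)%:R <= gamma' ^+ 2 * c / (4 * D).
  rewrite ler_pdivlMr ?mulr_gt0 // [leRHS]mulrC -ler_pdivrMr ?exprn_gt0 //.
  by rewrite le_max lexx orbT.
exists c; split; first exact: lt_le_trans c1.
move=> p G p01 lep deg.
have Fil : Filter (multiples_oo #|U|) by apply: within_filter.
have inf r : \forall n \near multiples_oo #|U|, r <= n%:R :> R.
  by apply: cvg_within; apply: nbhs_infty_ger.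
have mult : \forall n \near multiples_oo #|U|, (#|U| %| n)%N by apply: withinT.
apply: (squeeze_cvgr (f := fun n => 1 - n.+1%:R^-1) (h := fun=> 1)).
- near=> n.
  have deg' : a * n%:R <= (min_degree (G n))%:R.
    apply: le_trans (_ : alpha * n%:R <= _); last by near: n.
    by rewrite ler_wpM2r // ge_min lexx.
  apply: (@probability_bound R U H u0 a gamma eta eps gamma' c) => //.
  + by case/andP: (p01 n).
  + by near: n.
  + by rewrite -(ltr0n R); apply: lt_le_trans ltr01 _; near: n; apply: inf.
  + by near: n.
  + rewrite [leRHS]mulrC -ler_pdivrMr //; near: n; exact: inf.
- have : (fun n => 1 - harmonic n : R) @ \oo --> (1 - 0 : R).
    by apply: cvgB; [exact: cvg_cst|exact: cvg_harmonic].
  by rewrite subr0 => hc; apply: cvg_trans hc; apply: cvg_app; apply: cvg_within.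
- exact: cvg_cst.
Unshelve. all: by end_near.
Qed.
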